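(* Let $\mathbf U_L,\mathbf U_R\in\mathcal U_{\rm ad}$ be the left and right states of the Riemann problem for the one-dimensional shear shallow water model (with zero source term and linear path), with $h_L,h_R>0$, and put $c_L=\mathcal R_{11}^L/h_L^3$, $c_R=\mathcal R_{11}^R/h_R^3$. If $$u_R-u_L<\mathfrak a(h_L,c_L)+\mathfrak a(h_R,c_R),$$ then there exists a unique pair $(z_L,z_R)\in(0,2)\times(0,2)$ such that $$F(z_L,z_R)=0\quad\text{and}\quad G(z_L,z_R)=0,$$ where $$F(z_1,z_2)=f(z_1;h_L,\mathcal R_{11}^L)-f(z_2;h_R,\mathcal R_{11}^R),\qquad G(z_1,z_2)=g_-(z_1;h_L,u_L,\mathcal R_{11}^L)-g_+(z_2;h_R,u_R,\mathcal R_{11}^R).$$ Moreover, in this case the Riemann problem with data $\mathbf U_L$ for $x<0$ and $\mathbf U_R$ for $x>0$ has a unique, positive solution.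
   Context: Fix the constant $g>0$ (gravity). A state $\mathbf U$ is described by the depth $h$, velocity $(u,v)=(v_1,v_2)$ and a symmetric $2\times2$ tensor $\mathcal P$; put $\mathcal R=h\mathcal P$ and $\mathcal E_{ij}=\tfrac12\mathcal R_{ij}+\tfrac12 h v_iv_j$. The conserved variables are $\mathbf U=(h,hu,hv,\mathcal E_{11},\mathcal E_{12},\mathcal E_{22})$. The admissible set $\mathcal U_{\rm ad}$ consists of states with $h>0$ and $\mathcal R$ positive definite. The 1-D shear shallow water system without source is $\partial_t\mathbf U+\partial_x\mathbf F+\mathbf B\,\partial_x h=0$ with $\mathbf F=\big(hu,\ \mathcal R_{11}+hu^2+\tfrac12gh^2,\ \mathcal R_{12}+huv,\ (\mathcal E_{11}+\mathcal R_{11})u,\ \mathcal E_{12}u+\tfrac12(\mathcal R_{11}v+\mathcal R_{12}u),\ \mathcal E_{22}u+\mathcal R_{12}v\big)$ and $\mathbf B=(0,0,0,ghu,\tfrac12ghv,0)$. Its eigenvalues are $\lambda_1=u-\sqrt{gh+3\mathcal P_{11}}$, $\lambda_2=u-\sqrt{\mathcal P_{11}}$, $\lambda_3=\lambda_4=u$, $\lambda_5=u+\sqrt{\mathcal P_{11}}$, $\lambda_6=u+\sqrt{gh+3\mathcal P_{11}}$. Jump conditions. Write $[\![q]\!]=q_R-q_L$, $\langle q\rangle=\tfrac12(q_L+q_R)$. With the linear path $\Psi(\xi)=\mathbf U_L+\xi(\mathbf U_R-\mathbf U_L)$, the generalized Rankine–Hugoniot conditions across a discontinuity of speed $S$ are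 $[\![hu]\!]=S[\![h]\!]$; $[\![\mathcal R_{11}+hu^2+\tfrac12gh^2]\!]=S[\![hu]\!]$; $[\![\mathcal R_{12}+huv]\!]=S[\![hv]\!]$; $[\![\mathcal E_{11}u+\mathcal R_{11}u]\!]+g\langle hu\rangle[\![h]\!]=S[\![\mathcal E_{11}]\!]$; $[\![\mathcal E_{12}u+\tfrac12(\mathcal R_{11}v+\mathcal R_{12}u)]\!]+\tfrac12g\langle hv\rangle[\![h]\!]=S[\![\mathcal E_{12}]\!]$; $[\![\mathcal E_{22}u+\mathcal R_{12}v]\!]=S[\![\mathcal E_{22}]\!]$. Functions. For $h>0$, $c>0$: $\mathfrak a(h,c)=\sqrt{gh+3ch^2}+\frac{g}{\sqrt{3c}}\sinh^{-1}\sqrt{3ch/g}$. For $z\in(0,2)$: $$f(z;h,\mathcal R_{11})=\begin{cases}z^3\mathcal R_{11}+\frac12gz^2h^2,&0<z\le1,\\ \frac{2z-1}{2-z}\mathcal R_{11}+\frac12gh^2\frac{(z-1)^3}{2-z}+\frac12gz^2h^2,&1<z<2,\end{cases}$$ $$g_\pm(z;h,u,\mathcal R_{11})=\begin{cases}u\pm[\mathfrak a(zh,c)-\mathfrak a(h,c)],&0<z\le1,\\ u\pm\sqrt{\dfrac{(z-1)\,[f(z;h,\mathcal R_{11})-\mathcal R_{11}-\frac12gh^2]}{zh}},&1<z<2,\end{cases}\qquad c=\mathcal R_{11}/h^3.$$ Solutions of the Riemann problem. A solution is a self-similar function $\mathbf U(x/t)$ with values in $\mathcal U_{\rm ad}$,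 equal to $\mathbf U_L$ for $x/t$ very negative and $\mathbf U_R$ for $x/t$ very positive, made of constant states $\mathbf U_L,\mathbf U_{*L},\mathbf U_{**L},\mathbf U_{**R},\mathbf U_{*R},\mathbf U_R$ in this order, successively separated by the following waves (each possibly trivial, i.e. absent): (i) a 1-wave, which is either a 1-shock (a discontinuity of speed $S$ satisfying the Rankine–Hugoniot conditions above and the Lax condition $\lambda_1(\text{left})>S>\lambda_1(\text{right})$) or a 1-rarefaction (a continuous wave with $x/t=\lambda_1$ increasing from left to right, along which the quantities $\mathcal P_{11}/h^2$, $u+\mathfrak a(h,c)$, $\det\mathcal P/h^2$, $\frac{\mathcal P_{12}}{gh+2\mathcal P_{11}}$, $v+\frac{2\mathcal P_{12}}{gh+2\mathcal P_{11}}\mathfrak a(h,c)$, with $c=\mathcal P_{11}/h^2$, are constant); (ii) a 2-shear wave (discontinuity of speed $u-\sqrt{\mathcal P_{11}}$ across which $h,u,\mathcal P_{11},v\sqrt{\mathcal P_{11}}+\mathcal P_{12},\det\mathcal P$ are continuous); (iii) a contact wave (discontinuity of speed $u$ across which $u,v,\mathcal R_{12},\tfrac12gh^2+\mathcal R_{11}$ are continuous); (iv) a 5-shear wave (discontinuity of speed $u+\sqrt{\mathcal P_{11}}$ across which $h,u,\mathcal P_{11},v\sqrt{\mathcal P_{11}}-\mathcal P_{12},\det\mathcal P$ are continuous); (v) a 6-wave, which is either a 6-shock (Rankine–Hugoniot conditions and $\lambda_6(\text{left})>S>\lambda_6(\text{right})$) or a 6-rarefaction (continuous, $x/t=\lambda_6$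 increasing from left to right, with $\mathcal P_{11}/h^2$, $u-\mathfrak a(h,c)$, $\det\mathcal P/h^2$, $\frac{\mathcal P_{12}}{gh+2\mathcal P_{11}}$, $v-\frac{2\mathcal P_{12}}{gh+2\mathcal P_{11}}\mathfrak a(h,c)$ constant). The solution is positive if $h>0$ everywhere. *)

(* Defs.v *)
From Stdlib Require Import Reals List.
From Coquelicot Require Import Coquelicot.
Open Scope R_scope.

(** A state is stored through its primitive variables (h, u, v, P); for h > 0
    they correspond one-to-one to the conserved variables
    (h, hu, hv, E11, E12, E22). *)
Record state : Type := mkState {
  depth : R;
  vel1 : R;
  vel2 : R;
  P11 : R;
  P12 : R;
  P22 : R
}.

Definition R11 (U : state) : R := depth U * P11 U.
Definition R12 (U : state) : R := depth U * P12 U.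
Definition R22 (U : state) : R := depth U * P22 U.

Definition E11 (U : state) : R := R11 U / 2 + depth U * vel1 U * vel1 U / 2.
Definition E12 (U : state) : R := R12 U / 2 + depth U * vel1 U * vel2 U / 2.
Definition E22 (U : state) : R := R22 U / 2 + depth U * vel2 U * vel2 U / 2.

Definition detP (U : state) : R := P11 U * P22 U - P12 U ^ 2.

(** Positive definiteness of the symmetric matrix [[a, b], [b, c]]. *)
Definition posdef2 (a b c : R) : Prop :=
  forall x y : R, (x, y) <> (0, 0) ->
    0 < a * x ^ 2 + 2 * b * x * y + c * y ^ 2.

Definition admissible (U : state) : Prop :=
  0 < depth U /\ posdef2 (R11 U) (R12 U) (R22 U).

(** The eigenvalues; lambda3 = lambda4 is the velocity [vel1]. *)
Definition lambda1 (g : R) (U : state) : R :=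
  vel1 U - sqrt (g * depth U + 3 * P11 U).
Definition lambda2 (U : state) : R := vel1 U - sqrt (P11 U).
Definition lambda5 (U : state) : R := vel1 U + sqrt (P11 U).
Definition lambda6 (g : R) (U : state) : R :=
  vel1 U + sqrt (g * depth U + 3 * P11 U).

Definition jump (q : state -> R) (A B : state) : R := q B - q A.
Definition mean (q : state -> R) (A B : state) : R := (q A + q B) / 2.

Definition mom1 (U : state) : R := depth U * vel1 U.
Definition mom2 (U : state) : R := depth U * vel2 U.

(** Generalized Rankine-Hugoniot conditions, with left state [A], right state
    [B] and speed [S].  Along the linear path in the conserved variables
    (h, hu, hv, E11, E12, E22) the nonconservative products g h u h_x and
    g h v h_x / 2 contribute the terms with mean values. *)
Definition rankine_hugoniot (g : R) (A B : state) (S : R) : Prop :=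
  jump mom1 A B = S * jump depth A B /\
  jump (fun U => R11 U + depth U * vel1 U ^ 2 + g * depth U ^ 2 / 2) A B
    = S * jump mom1 A B /\
  jump (fun U => R12 U + depth U * vel1 U * vel2 U) A B
    = S * jump mom2 A B /\
  jump (fun U => E11 U * vel1 U + R11 U * vel1 U) A B
    + g * mean mom1 A B * jump depth A B = S * jump E11 A B /\
  jump (fun U => E12 U * vel1 U + (R11 U * vel2 U + R12 U * vel1 U) / 2) A B
    + g * mean mom2 A B * jump depth A B / 2 = S * jump E12 A B /\
  jump (fun U => E22 U * vel1 U + R12 U * vel2 U) A B = S * jump E22 A B.

Definition afun (g h c : R) : R :=
  sqrt (g * h + 3 * c * h ^ 2)
  + g / sqrt (3 * c) * arcsinh (sqrt (3 * c * h / g)).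

(** The next two functions are meaningful for 0 < z < 2 only. *)
Definition fcurve (g z h r11 : R) : R :=
  if Rle_dec z 1 then z ^ 3 * r11 + g * z ^ 2 * h ^ 2 / 2
  else (2 * z - 1) / (2 - z) * r11
       + g * h ^ 2 / 2 * ((z - 1) ^ 3 / (2 - z))
       + g * z ^ 2 * h ^ 2 / 2.

Definition gcurve (g z h r11 : R) : R :=
  if Rle_dec z 1 then afun g (z * h) (r11 / h ^ 3) - afun g h (r11 / h ^ 3)
  else sqrt ((z - 1) * (fcurve g z h r11 - r11 - g * h ^ 2 / 2) / (z * h)).

Definition gplus (g z h u r11 : R) : R := u + gcurve g z h r11.
Definition gminus (g z h u r11 : R) : R := u - gcurve g z h r11.

Definition Fstar (g : R) (UL UR : state) (z1 z2 : R) : R :=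
  fcurve g z1 (depth UL) (R11 UL) - fcurve g z2 (depth UR) (R11 UR).

Definition Gstar (g : R) (UL UR : state) (z1 z2 : R) : R :=
  gminus g z1 (depth UL) (vel1 UL) (R11 UL)
  - gplus g z2 (depth UR) (vel1 UR) (R11 UR).

(** Elementary waves.  [A] is the state to the left of the wave, [B] the state
    to its right, and [W] the self-similar profile, a function of xi = x/t. *)

Definition shock1 (g : R) (A B : state) (S : R) : Prop :=
  rankine_hugoniot g A B S /\ lambda1 g A > S /\ S > lambda1 g B.

Definition shock6 (g : R) (A B : state) (S : R) : Prop :=
  rankine_hugoniot g A B S /\ lambda6 g A > S /\ S > lambda6 g B.

Definition profile_continuous_on (W : R -> state) (a b : R) : Prop :=
  forall q : state -> R, In q (depth :: vel1 :: vel2 :: P11 :: P12 :: P22 :: nil) ->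
    continuous_on (fun xi => a <= xi <= b) (fun xi => q (W xi)).

Definition constant_along (q : state -> R) (W : R -> state) (a b : R) : Prop :=
  forall xi, a <= xi <= b -> q (W xi) = q (W a).

Definition afun_st (g : R) (U : state) : R :=
  afun g (depth U) (P11 U / depth U ^ 2).

Definition shear_ratio (g : R) (U : state) : R :=
  P12 U / (g * depth U + 2 * P11 U).

Definition rarefaction1 (g : R) (W : R -> state) (A B : state) (a b : R) : Prop :=
  W a = A /\ W b = B /\
  profile_continuous_on W a b /\
  (forall xi, a <= xi <= b -> lambda1 g (W xi) = xi) /\
  constant_along (fun U => P11 U / depth U ^ 2) W a b /\
  constant_along (fun U => vel1 U + afun_st g U) W a b /\
  constant_along (fun U => detP U / depth U ^ 2) W a b /\
  constant_along (shear_ratio g) W a b /\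
  constant_along (fun U => vel2 U + 2 * shear_ratio g U * afun_st g U) W a b.

Definition rarefaction6 (g : R) (W : R -> state) (A B : state) (a b : R) : Prop :=
  W a = A /\ W b = B /\
  profile_continuous_on W a b /\
  (forall xi, a <= xi <= b -> lambda6 g (W xi) = xi) /\
  constant_along (fun U => P11 U / depth U ^ 2) W a b /\
  constant_along (fun U => vel1 U - afun_st g U) W a b /\
  constant_along (fun U => detP U / depth U ^ 2) W a b /\
  constant_along (shear_ratio g) W a b /\
  constant_along (fun U => vel2 U - 2 * shear_ratio g U * afun_st g U) W a b.

(** A 1-wave (6-wave) occupies a <= xi <= b: it is trivial (no jump, at an
    arbitrary position), a shock (a = b), or a rarefaction fan (a < b). *)
Definition wave1 (g : R) (W : R -> state) (A B : state) (a b : R) : Prop :=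
  (a = b /\ A = B) \/ (a = b /\ shock1 g A B a) \/ (a < b /\ rarefaction1 g W A B a b).

Definition wave6 (g : R) (W : R -> state) (A B : state) (a b : R) : Prop :=
  (a = b /\ A = B) \/ (a = b /\ shock6 g A B a) \/ (a < b /\ rarefaction6 g W A B a b).

(** The three linearly degenerate waves; A = B is the trivial wave. *)
Definition shear2 (A B : state) (s : R) : Prop :=
  s = lambda2 A /\
  depth A = depth B /\ vel1 A = vel1 B /\ P11 A = P11 B /\
  vel2 A * sqrt (P11 A) + P12 A = vel2 B * sqrt (P11 B) + P12 B /\
  detP A = detP B.

Definition contact (g : R) (A B : state) (s : R) : Prop :=
  s = vel1 A /\
  vel1 A = vel1 B /\ vel2 A = vel2 B /\ R12 A = R12 B /\
  g * depth A ^ 2 / 2 + R11 A = g * depth B ^ 2 / 2 + R11 B.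

Definition shear5 (A B : state) (s : R) : Prop :=
  s = lambda5 A /\
  depth A = depth B /\ vel1 A = vel1 B /\ P11 A = P11 B /\
  vel2 A * sqrt (P11 A) - P12 A = vel2 B * sqrt (P11 B) - P12 B /\
  detP A = detP B.

(** The function (x, t) |-> W (x / t) solves the Riemann problem with data
    [UL] for x < 0 and [UR] for x > 0.  The value of [W] at the position of a
    discontinuity is only required to be admissible. *)
Definition riemann_solution (g : R) (UL UR : state) (W : R -> state) : Prop :=
  (forall xi, admissible (W xi)) /\
  exists (UsL UssL UssR UsR : state) (a1 b1 s2 s3 s5 a6 b6 : R),
    (admissible UsL /\ admissible UssL /\ admissible UssR /\ admissible UsR) /\
    (b1 <= s2 /\ s2 <= s3 /\ s3 <= s5 /\ s5 <= a6) /\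
    wave1 g W UL UsL a1 b1 /\
    shear2 UsL UssL s2 /\
    contact g UssL UssR s3 /\
    shear5 UssR UsR s5 /\
    wave6 g W UsR UR a6 b6 /\
    (forall xi, xi < a1 -> W xi = UL) /\
    (forall xi, b1 < xi < s2 -> W xi = UsL) /\
    (forall xi, s2 < xi < s3 -> W xi = UssL) /\
    (forall xi, s3 < xi < s5 -> W xi = UssR) /\
    (forall xi, s5 < xi < a6 -> W xi = UsR) /\
    (forall xi, b6 < xi -> W xi = UR).

Definition positive_profile (W : R -> state) : Prop := forall xi, 0 < depth (W xi).

(** Profiles are identified when they differ at finitely many values of x/t
    only, since the value at a discontinuity is conventional. *)
Definition same_profile (W W' : R -> state) : Prop :=
  exists l : list R, forall xi, ~ In xi l -> W xi = W' xi.

(* Main.v *)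
Require Import Defs.
From Stdlib Require Import Reals Lra List IndefiniteDescription Ranalysis5.
From Coquelicot Require Import Coquelicot.
Open Scope R_scope.

(** Every state that a 1-wave can connect to a given left state [A] is determined by
    its depth ratio [z] to [A]: rarefactions give [0 < z < 1]; for shocks, eliminating
    the mass flux from the mass, normal momentum and normal energy balances yields
    [1 < z < 2], as [z <= 1] contradicts the Lax condition and [z >= 2] the positivity
    of [P11].  The velocity and total pressure
    behind the wave are the curves [gminus] and [fcurve].  Reflecting the line turns
    6-waves into 1-waves.  The contact and shear waves match the velocity and total
    pressure, which is the system [F = G = 0], and then determine the remaining
    components by a linear system.  Since the curves are increasing in [z], the system
    has at most one solution; one exists by the intermediate value theorem along the
    curve [F = 0], because the ranges of the velocity curves overlap exactly under the
    no-vacuum condition. *)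

(** * Intersection of monotone curves *)

(** The depth ratio can fix a whole state because the transverse components follow the normal ones:
    with [s] the shear ratio, both [s] and [vel2 - 2 s vel1] keep their values across a 1-shock and
    along a 1-rarefaction. What remains, [P22], comes from [detP] in a fan and from the last balance
    across a shock, where positive definiteness of the new state is a separate polynomial
    inequality. The no-vacuum bound appears because [afun] vanishes at depth zero: each velocity
    curve ranges over all values above minus [afun] of its data. The waves found must also come in
    the right order, so 1-waves are shown to end strictly to the left of the 2-shear wave.
    Uniqueness can hold only up to finitely many values of [x/t]: the value at a jump is free, and a
    trivial wave has no definite position. *)

Lemma inverse_continuity_pt (I J : R -> Prop) (f phi : R -> R) :
  (forall x y, I x -> I y -> x < y -> f x < f y) ->
  (forall x, I x -> J (f x)) ->
  (forall x y z, J x -> J z -> x <= y <= z -> J y) ->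
  (forall y, J y -> I (phi y) /\ f (phi y) = y) ->
  (forall x, I x -> exists d, 0 < d /\ forall t, Rabs (t - x) < d -> I t) ->
  forall y, J y -> continuity_pt phi y.
Proof.
  intros Hinc HIJ HJ Hphi Hop y Hy eps Heps.
  destruct (Hphi y Hy) as [Ix fx].
  destruct (Hop _ Ix) as (d & Hd & Hball).
  set (x := phi y) in *.
  set (e := Rmin eps d / 2).
  assert (He : 0 < e /\ e < eps /\ e < d).
  { unfold e. pose proof (Rmin_l eps d). pose proof (Rmin_r eps d).
    pose proof (Rmin_glb_lt eps d 0 Heps Hd). lra. }
  assert (I1 : I (x - e)).
  { apply Hball. replace (x - e - x) with (- e) by ring.
    rewrite Rabs_Ropp, Rabs_pos_eq; lra. }
  assert (I2 : I (x + e)).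
  { apply Hball. replace (x + e - x) with e by ring. rewrite Rabs_pos_eq; lra. }
  (* Monotonicity alone makes the inverse continuous: a value [t] between [f (x - e)] and
     [f (x + e)] lies in [J] by convexity, and its preimage lies between [x - e] and [x + e]. *)
  assert (L1 : f (x - e) < y) by (rewrite <- fx; apply Hinc; auto; lra).
  assert (L2 : y < f (x + e)) by (rewrite <- fx; apply Hinc; auto; lra).
  exists (Rmin (y - f (x - e)) (f (x + e) - y)). split.
  { apply Rmin_glb_lt; lra. }
  intros t [_ Ht]. simpl in *. unfold R_dist in *. fold x.
  pose proof (Rmin_l (y - f (x - e)) (f (x + e) - y)).
  pose proof (Rmin_r (y - f (x - e)) (f (x + e) - y)).
  apply Rabs_def2 in Ht.
  assert (Jt : J t) by (apply (HJ (f (x - e)) t (f (x + e))); auto; lra).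
  destruct (Hphi t Jt) as [It ft].
  apply Rabs_def1.
  - destruct (Rlt_or_le (phi t) (x + e)) as [|C]; [lra|].
    destruct C as [C|C]; [apply Hinc in C; auto; lra|rewrite C in L2; lra].
  - destruct (Rlt_or_le (x - e) (phi t)) as [|C]; [lra|].
    destruct C as [C|C]; [apply Hinc in C; auto; lra|rewrite <- C in L1; lra].
Qed.

Lemma increasing_onto_bounds (I : R -> Prop) (f : R -> R) (y : R) :
  (forall x t z, I x -> I z -> x <= t <= z -> I t) ->
  (forall x, I x -> continuity_pt f x) ->
  (forall x t, I x -> I t -> x < t -> f x < f t) ->
  (exists x, I x /\ f x <= y) -> (exists x, I x /\ y <= f x) ->
  exists x, I x /\ f x = y.
Proof.
  intros HI Hc Hinc (x1 & I1 & H1) (x2 & I2 & H2).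
  destruct (Req_dec (f x1) y) as [E1|N1]; [exists x1; auto|].
  destruct (Req_dec (f x2) y) as [E2|N2]; [exists x2; auto|].
  assert (L : x1 < x2).
  { destruct (Rlt_or_le x1 x2) as [|[C|C]]; auto.
    - apply Hinc in C; auto; lra.
    - subst; lra. }
  destruct (IVT_interv (fun x => f x - y) x1 x2) as (x & Hx & Ex).
  - intros a Ha. apply continuity_pt_minus.
    + apply Hc, (HI x1 a x2); auto.
    + apply continuity_pt_const. intros ? ?; reflexivity.
  - exact L.
  - lra.
  - lra.
  - exists x. split; [apply (HI x1 x x2); auto | lra].
Qed.

Definition in02 (z : R) : Prop := 0 < z < 2.

Lemma in02_convex x y z : in02 x -> in02 z -> x <= y <= z -> in02 y.
Proof. unfold in02; lra. Qed.

Lemma in02_open x : in02 x -> exists d, 0 < d /\ forall t, Rabs (t - x) < d -> in02 t.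
Proof.
  intros [H1 H2]. exists (Rmin x (2 - x)). split; [apply Rmin_glb_lt; lra|].
  intros t Ht. apply Rabs_def2 in Ht.
  pose proof (Rmin_l x (2 - x)). pose proof (Rmin_r x (2 - x)). unfold in02; lra.
Qed.

Definition increasing02 (f : R -> R) : Prop :=
  forall x y, in02 x -> in02 y -> x < y -> f x < f y.
Definition continuous02 (f : R -> R) : Prop := forall x, in02 x -> continuity_pt f x.
Definition onto02 (f : R -> R) (m : R) : Prop :=
  (forall x, in02 x -> m < f x) /\ forall y, m < y -> exists x, in02 x /\ f x = y.

Lemma increasing02_inj f x y :
  increasing02 f -> in02 x -> in02 y -> f x = f y -> x = y.
Proof.
  intros H Hx Hy E. destruct (Rtotal_order x y) as [L|[L|L]]; auto;
  apply H in L; auto; lra.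
Qed.

Lemma increasing02_lt_inv f x y :
  increasing02 f -> in02 x -> in02 y -> f x < f y -> x < y.
Proof.
  intros H Hx Hy E. destruct (Rlt_or_le x y) as [|[L|L]]; auto.
  - apply H in L; auto; lra.
  - subst; lra.
Qed.

(** Points of the curve [f1 = f2] are parametrised by [x], with second coordinate [phi (f1 x)] for
    an inverse [phi] of [f2]. The velocity sum is below [d] at [x1], where the second coordinate is
    less than [x2], and above [d] at the [y1] with [f1 y1 = f2 x2], where it equals [x2] while
    [y1 > x1]. *)
Lemma curve_intersection_lt (f1 f2 g1 g2 : R -> R) (d x1 x2 : R) :
  increasing02 f1 -> increasing02 f2 -> increasing02 g1 -> increasing02 g2 ->
  continuous02 f1 -> continuous02 f2 -> continuous02 g1 -> continuous02 g2 ->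
  onto02 f1 0 -> onto02 f2 0 ->
  in02 x1 -> in02 x2 -> g1 x1 + g2 x2 = d -> f1 x1 < f2 x2 ->
  exists z1 z2, in02 z1 /\ in02 z2 /\ f1 z1 = f2 z2 /\ g1 z1 + g2 z2 = d.
Proof.
  intros If1 If2 Ig1 Ig2 Cf1 Cf2 Cg1 Cg2 [P1 O1] [P2 O2] H1 H2 E L.
  assert (Hphi : exists phi, forall y, 0 < y -> in02 (phi y) /\ f2 (phi y) = y).
  { apply (functional_choice (fun y x => 0 < y -> in02 x /\ f2 x = y)).
    intros y. destruct (Rlt_or_le 0 y) as [Hy|Hy].
    - destruct (O2 y Hy) as (x & Hx). exists x; auto.
    - exists 0. lra. }
  destruct Hphi as [phi Hphi].
  destruct (O1 (f2 x2) (P2 _ H2)) as (y1 & Hy1 & Ey1).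
  assert (Lxy : x1 < y1) by (apply (increasing02_lt_inv f1); auto; lra).
  assert (Ephi2 : phi (f1 y1) = x2).
  { destruct (Hphi (f1 y1) (P1 _ Hy1)) as [A B].
    apply (increasing02_inj f2); auto. lra. }
  assert (Lphi : phi (f1 x1) < x2).
  { destruct (Hphi (f1 x1) (P1 _ H1)) as [A B].
    apply (increasing02_lt_inv f2); auto. lra. }
  destruct (IVT_interv (fun x => (g1 x + g2 (phi (f1 x))) - d) x1 y1) as (z & Hz & Ez).
  - intros a Ha. assert (Ia : in02 a) by (apply (in02_convex x1 a y1); auto).
    destruct (Hphi (f1 a) (P1 _ Ia)) as [Ip Ep].
    apply continuity_pt_minus; [|apply continuity_pt_const; intros ? ?; reflexivity].
    apply continuity_pt_plus; [auto|].
    change (continuity_pt (comp g2 (comp phi f1)) a).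
    apply continuity_pt_comp; [apply continuity_pt_comp; [auto|]|].
    + apply (inverse_continuity_pt in02 (fun y => 0 < y) f2); auto.
      * intros; lra.
      * apply in02_open.
    + apply Cg2, Ip.
  - exact Lxy.
  - destruct (Hphi (f1 x1) (P1 _ H1)) as [A B]. apply Ig2 in Lphi; auto. lra.
  - rewrite Ephi2. apply Ig1 in Lxy; auto. lra.
  - assert (Iz : in02 z) by (apply (in02_convex x1 z y1); auto).
    destruct (Hphi (f1 z) (P1 _ Iz)) as [A B].
    exists z, (phi (f1 z)). repeat split; try apply A; try apply Iz; auto. lra.
Qed.

Lemma curve_intersection (f1 f2 g1 g2 : R -> R) (d m1 m2 : R) :
  increasing02 f1 -> increasing02 f2 -> increasing02 g1 -> increasing02 g2 ->
  continuous02 f1 -> continuous02 f2 -> continuous02 g1 -> continuous02 g2 ->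
  onto02 f1 0 -> onto02 f2 0 -> onto02 g1 m1 -> onto02 g2 m2 ->
  m1 + m2 < d ->
  exists z1 z2, in02 z1 /\ in02 z2 /\ f1 z1 = f2 z2 /\ g1 z1 + g2 z2 = d.
Proof.
  intros If1 If2 Ig1 Ig2 Cf1 Cf2 Cg1 Cg2 O1 O2 [_ Og1] [_ Og2] Hd.
  (* Half of the surplus [d - m1 - m2] goes to each curve, so both prescribed values exceed the
     infima. The resulting point solves the velocity equation, and the order of its two pressures
     tells which side to move from. *)
  destruct (Og1 (m1 + (d - m1 - m2) / 2)) as (x1 & H1 & E1); [lra|].
  destruct (Og2 (m2 + (d - m1 - m2) / 2)) as (x2 & H2 & E2); [lra|].
  destruct (Rtotal_order (f1 x1) (f2 x2)) as [L|[L|L]].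
  - apply (curve_intersection_lt f1 f2 g1 g2 d x1 x2); auto; lra.
  - exists x1, x2. repeat split; auto; try apply H1; try apply H2. lra.
  - destruct (curve_intersection_lt f2 f1 g2 g1 d x2 x1) as (z2 & z1 & ? & ? & ? & ?);
      auto; try lra.
    exists z1, z2. repeat split; auto; try apply H; try apply H0; lra.
Qed.

(** If one coordinate increases, equality of the pressures forces the other to increase too, and
    then the velocity sum increases strictly. *)
Lemma curve_intersection_unique (f1 f2 g1 g2 : R -> R) (x1 x2 y1 y2 : R) :
  increasing02 f1 -> increasing02 f2 -> increasing02 g1 -> increasing02 g2 ->
  in02 x1 -> in02 x2 -> in02 y1 -> in02 y2 ->
  f1 x1 = f2 x2 -> f1 y1 = f2 y2 -> g1 x1 + g2 x2 = g1 y1 + g2 y2 ->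
  x1 = y1 /\ x2 = y2.
Proof.
  intros If1 If2 Ig1 Ig2 Hx1 Hx2 Hy1 Hy2 Ex Ey Eg.
  assert (x1 = y1).
  { destruct (Rtotal_order x1 y1) as [L|[L|L]]; auto; exfalso.
    - assert (x2 < y2) by (apply (increasing02_lt_inv f2); auto; apply If1 in L; auto; lra).
      apply Ig1 in L; auto. apply Ig2 in H; auto. lra.
    - assert (y2 < x2) by (apply (increasing02_lt_inv f2); auto; apply If1 in L; auto; lra).
      apply Ig1 in L; auto. apply Ig2 in H; auto. lra. }
  split; auto. subst. apply (increasing02_inj f2); auto. lra.
Qed.

(** * Functions given by different formulas on the two sides of a point *)

Lemma continuity_pt_cst (k x : R) : continuity_pt (fun _ => k) x.
Proof. apply continuity_pt_const; intros ? ?; reflexivity. Qed.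

Lemma continuity_pt_var (x : R) : continuity_pt (fun z => z) x.
Proof. apply derivable_continuous_pt, derivable_pt_id. Qed.

(** The case split equals [f1 (Rmin z c) + f2 (Rmax z c) - f1 c], in which one of the first two
    terms is always frozen at the junction. Continuity of a branch is thus asked only at points on
    its own side of [c]. *)
Lemma continuity_pt_glue (f1 f2 : R -> R) (c x : R) :
  f1 c = f2 c -> continuity_pt f1 (Rmin x c) -> continuity_pt f2 (Rmax x c) ->
  continuity_pt (fun z => if Rle_dec z c then f1 z else f2 z) x.
Proof.
  intros E H1 H2.
  apply continuity_pt_ext with (fun z => f1 (Rmin z c) + f2 (Rmax z c) - f1 c).
  { intros z. destruct (Rle_dec z c).
    - rewrite Rmin_left, Rmax_right by lra. lra.
    - rewrite Rmin_right, Rmax_left by lra. lra. }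
  pose proof (fun k => continuity_pt_cst k x) as Hcst.
  pose proof (continuity_pt_var x) as Hid.
  assert (Habs : continuity_pt (fun z => Rabs (z - c)) x).
  { apply (continuity_pt_comp (fun z => z - c) Rabs).
    - apply continuity_pt_minus; auto.
    - apply Rcontinuity_abs. }
  apply continuity_pt_minus; [apply continuity_pt_plus|auto].
  - apply (continuity_pt_comp (fun z => Rmin z c) f1); [|exact H1].
    apply continuity_pt_ext with (fun z => (z + c - Rabs (z - c)) * / 2).
    + intros z. unfold Rmin, Rabs. destruct (Rle_dec z c), (Rcase_abs (z - c)); lra.
    + apply continuity_pt_mult; auto. apply continuity_pt_minus; auto.
      apply continuity_pt_plus; auto.
  - apply (continuity_pt_comp (fun z => Rmax z c) f2); [|exact H2].
    apply continuity_pt_ext with (fun z => (z + c + Rabs (z - c)) * / 2).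
    + intros z. unfold Rmax, Rabs. destruct (Rle_dec z c), (Rcase_abs (z - c)); lra.
    + apply continuity_pt_mult; auto. apply continuity_pt_plus; auto.
      apply continuity_pt_plus; auto.
Qed.

Lemma increasing02_glue (f1 f2 : R -> R) :
  f1 1 = f2 1 ->
  (forall x y, 0 < x -> x < y -> y <= 1 -> f1 x < f1 y) ->
  (forall x y, 1 <= x -> x < y -> y < 2 -> f2 x < f2 y) ->
  increasing02 (fun z => if Rle_dec z 1 then f1 z else f2 z).
Proof.
  intros E H1 H2 x y [Hx Hx'] [Hy Hy'] L.
  destruct (Rle_dec x 1), (Rle_dec y 1); try lra.
  - apply H1; lra.
  - apply Rle_lt_trans with (f1 1).
    + destruct (Req_dec x 1); [subst; lra|left; apply H1; lra].
    + rewrite E; apply H2; lra.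
  - apply H2; lra.
Qed.

(** * The wave curves *)

Lemma continuity_pt_arcsinh (x : R) : continuity_pt arcsinh x.
Proof.
  apply derivable_continuous_pt. exists (/ sqrt (x ^ 2 + 1)).
  apply derivable_pt_lim_arcsinh.
Qed.

Ltac cont_poly :=
  apply derivable_continuous_pt, ex_derive_Reals_0; auto_derive.

Lemma afun_0 g c : afun g 0 c = 0.
Proof.
  unfold afun. replace (g * 0 + 3 * c * 0 ^ 2) with 0 by ring.
  replace (3 * c * 0 / g) with 0 by (unfold Rdiv; ring).
  rewrite sqrt_0, arcsinh_0. ring.
Qed.

Lemma afun_lt g c h1 h2 :
  0 < g -> 0 < c -> 0 <= h1 -> h1 < h2 -> afun g h1 c < afun g h2 c.
Proof.
  intros Hg Hc H1 H2. unfold afun.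
  apply Rplus_lt_compat.
  - apply sqrt_lt_1_alt.
    assert (h1 ^ 2 <= h2 ^ 2) by (apply pow_incr; lra).
    assert (g * h1 < g * h2) by (apply Rmult_lt_compat_l; auto).
    assert (c * h1 ^ 2 <= c * h2 ^ 2) by (apply Rmult_le_compat_l; lra).
    assert (0 <= c * h1 ^ 2) by (apply Rmult_le_pos; [lra | apply pow_le; auto]).
    assert (0 <= g * h1) by (apply Rmult_le_pos; lra).
    lra.
  - apply Rmult_lt_compat_l.
    + apply Rdiv_lt_0_compat; auto. apply sqrt_lt_R0; lra.
    + apply arcsinh_lt. apply sqrt_lt_1_alt. split.
      * apply Rdiv_le_0_compat; auto. nra.
      * apply Rmult_lt_compat_r; [apply Rinv_0_lt_compat; auto|nra].
Qed.

Lemma afun_continuity_pt g c h :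
  0 < g -> 0 < c -> 0 <= h -> continuity_pt (fun x => afun g x c) h.
Proof.
  intros Hg Hc Hh. unfold afun.
  apply continuity_pt_plus; [|apply continuity_pt_mult; [apply continuity_pt_cst|]].
  - apply (continuity_pt_comp (fun x => g * x + 3 * c * x ^ 2) sqrt).
    + cont_poly; auto.
    + apply continuity_pt_sqrt. nra.
  - apply (continuity_pt_comp (fun x => sqrt (3 * c * x / g)) arcsinh).
    + apply (continuity_pt_comp (fun x => 3 * c * x / g) sqrt).
      * cont_poly; auto.
      * apply continuity_pt_sqrt. apply Rdiv_le_0_compat; nra.
    + apply continuity_pt_arcsinh.
Qed.

Definition fshock (g z h r : R) : R :=
  (2 * z - 1) / (2 - z) * r + g * h ^ 2 / 2 * ((z - 1) ^ 3 / (2 - z)) + g * z ^ 2 * h ^ 2 / 2.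

(** The factor [z - 1] makes the radicand of the shock velocity a multiple of [(z - 1) ^ 2], and the
    term over [2 - z] exhibits the blow-up at 2. *)
Lemma fshock_excess g z h r :
  z < 2 ->
  fshock g z h r - r - g * h ^ 2 / 2
  = (z - 1) * ((3 * r + g * h ^ 2 / 2 * (z - 1) ^ 2) / (2 - z) + g * h ^ 2 / 2 * (z + 1)).
Proof. intros. unfold fshock. field. lra. Qed.

Lemma inv_lt_gap x y : x < y -> y < 2 -> / (2 - x) < / (2 - y).
Proof. intros. apply Rinv_lt_contravar; nra. Qed.

Lemma pow_lt_incr n x y : 0 <= x -> x < y -> x ^ S n < y ^ S n.
Proof.
  intros Hx L. induction n as [|n IH]; [simpl; lra|].
  change (x * x ^ S n < y * y ^ S n).
  assert (0 <= x ^ S n) by (apply pow_le; auto).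
  apply Rmult_le_0_lt_compat; auto.
Qed.

Lemma fshock_lt g h r x y :
  0 < g -> 0 < h -> 0 < r -> 1 <= x -> x < y -> y < 2 -> fshock g x h r < fshock g y h r.
Proof.
  intros Hg Hh Hr Hx L Hy. unfold fshock.
  pose proof (inv_lt_gap x y L Hy) as Hinv.
  assert (0 < / (2 - x)) by (apply Rinv_0_lt_compat; lra).
  assert (0 < g * h ^ 2) by (apply Rmult_lt_0_compat; auto; apply pow_lt; auto).
  assert (P2 : x ^ 2 < y ^ 2) by (apply pow_lt_incr; lra).
  assert (P3 : (x - 1) ^ 3 < (y - 1) ^ 3) by (apply pow_lt_incr; lra).
  assert (0 <= (x - 1) ^ 3) by (apply pow_le; lra).
  assert (A1 : (2 * x - 1) / (2 - x) < (2 * y - 1) / (2 - y))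
    by (apply Rmult_le_0_lt_compat; lra).
  assert (A2 : (x - 1) ^ 3 / (2 - x) < (y - 1) ^ 3 / (2 - y))
    by (apply Rmult_le_0_lt_compat; lra).
  assert (g * h ^ 2 * x ^ 2 < g * h ^ 2 * y ^ 2) by (apply Rmult_lt_compat_l; auto).
  assert ((2 * x - 1) / (2 - x) * r < (2 * y - 1) / (2 - y) * r)
    by (apply Rmult_lt_compat_r; auto).
  assert (g * h ^ 2 / 2 * ((x - 1) ^ 3 / (2 - x)) < g * h ^ 2 / 2 * ((y - 1) ^ 3 / (2 - y)))
    by (apply Rmult_lt_compat_l; lra).
  lra.
Qed.

Lemma fcurve_increasing g h r : 0 < g -> 0 < h -> 0 < r -> increasing02 (fun z => fcurve g z h r).
Proof.
  intros Hg Hh Hr. unfold fcurve.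
  apply (increasing02_glue (fun z => z ^ 3 * r + g * z ^ 2 * h ^ 2 / 2) (fun z => fshock g z h r)).
  - unfold fshock. field.
  - intros x y Hx L Hy.
    assert (P2 : x ^ 2 < y ^ 2) by (apply pow_lt_incr; lra).
    assert (P3 : x ^ 3 < y ^ 3) by (apply pow_lt_incr; lra).
    assert (0 < g * h ^ 2) by (apply Rmult_lt_0_compat; auto; apply pow_lt; auto).
    assert (g * h ^ 2 * x ^ 2 < g * h ^ 2 * y ^ 2) by (apply Rmult_lt_compat_l; auto).
    assert (x ^ 3 * r < y ^ 3 * r) by (apply Rmult_lt_compat_r; auto).
    lra.
  - intros. apply fshock_lt; auto.
Qed.

Lemma fcurve_continuous g h r : continuous02 (fun z => fcurve g z h r).
Proof.
  intros z [H1 H2]. unfold fcurve.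
  apply (continuity_pt_glue (fun z => z ^ 3 * r + g * z ^ 2 * h ^ 2 / 2)
           (fun z => fshock g z h r)).
  - unfold fshock. field.
  - cont_poly; auto.
  - assert (Rmax z 1 < 2) by (apply Rmax_lub_lt; lra).
    unfold fshock. cont_poly. lra.
Qed.

Lemma fcurve_onto g h r : 0 < g -> 0 < h -> 0 < r -> onto02 (fun z => fcurve g z h r) 0.
Proof.
  intros Hg Hh Hr.
  assert (Hgh : 0 < g * h ^ 2) by (apply Rmult_lt_0_compat; auto; apply pow_lt; auto).
  assert (Hpos : forall x, in02 x -> 0 < fcurve g x h r).
  { intros x [Hx1 Hx2]. unfold fcurve.
    assert (0 < x ^ 2) by (apply pow_lt; auto).
    assert (0 < x ^ 3) by (apply pow_lt; auto).
    destruct (Rle_dec x 1).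
    - assert (0 < x ^ 3 * r) by nra. nra.
    - assert (0 < (2 * x - 1) / (2 - x)) by (apply Rdiv_lt_0_compat; lra).
      assert (0 < (x - 1) ^ 3 / (2 - x)) by (apply Rdiv_lt_0_compat; [apply pow_lt|]; lra).
      nra. }
  split; auto.
  intros y Hy. apply (increasing_onto_bounds in02 (fun z => fcurve g z h r) y).
  - apply in02_convex.
  - apply fcurve_continuous.
  - apply fcurve_increasing; auto.
  (* [K] is the total pressure at [z = 1]. On (0, 1] both [z ^ 3] and [z ^ 2] are at most [z], so
     the curve stays below [z * K]. *)
  - set (K := r + g * h ^ 2 / 2).
    set (x := Rmin 1 (y / K)).
    assert (HK : 0 < K) by (unfold K; lra).
    assert (0 < y / K) by (apply Rdiv_lt_0_compat; auto).
    pose proof (Rmin_l 1 (y / K)). pose proof (Rmin_r 1 (y / K)).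
    assert (0 < x) by (apply Rmin_glb_lt; lra). fold x in H0, H1.
    exists x. split; [unfold in02; lra|].
    unfold fcurve. destruct (Rle_dec x 1); [|lra].
    assert (x * K <= y).
    { apply Rle_trans with (y / K * K); [apply Rmult_le_compat_r; lra|].
      right; field; lra. }
    assert (x ^ 2 <= x) by nra. assert (x ^ 3 <= x) by nra.
    assert (x ^ 3 * r <= x * r) by nra.
    assert (g * h ^ 2 * x ^ 2 <= g * h ^ 2 * x) by nra.
    unfold K in *. lra.
  (* At [2 - d] the summand with [r] alone is at least [r / d], because [d <= 1 / 2] keeps its
     numerator above 1; and [r / d >= y]. *)
  - set (d := Rmin (1 / 2) (r / y)).
    assert (0 < r / y) by (apply Rdiv_lt_0_compat; auto).
    pose proof (Rmin_l (1 / 2) (r / y)). pose proof (Rmin_r (1 / 2) (r / y)).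
    assert (0 < d) by (apply Rmin_glb_lt; lra). fold d in H0, H1.
    exists (2 - d). split; [unfold in02; lra|].
    unfold fcurve. destruct (Rle_dec (2 - d) 1); [lra|].
    replace (2 - (2 - d)) with d by ring.
    assert (y * d <= r).
    { apply Rle_trans with (y * (r / y)); [apply Rmult_le_compat_l; lra|].
      right; field; lra. }
    assert (y <= (2 * (2 - d) - 1) / d * r).
    { apply Rle_trans with (r / d).
      - apply Rmult_le_reg_r with d; auto. unfold Rdiv.
        rewrite Rmult_assoc, Rinv_l by lra. lra.
      - assert (0 < r / d) by (apply Rdiv_lt_0_compat; auto).
        replace ((2 * (2 - d) - 1) / d * r) with ((2 * (2 - d) - 1) * (r / d)) by (field; lra).
        nra. }
    assert (0 <= (2 - d - 1) ^ 3 / d) by (apply Rdiv_le_0_compat; auto; apply pow_le; lra).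
    assert (0 <= (2 - d) ^ 2) by (apply pow_le; lra).
    nra.
Qed.

(** Stated with [fcurve] rather than [fshock] so that it is literally the second branch of
    [gcurve]. *)
Definition gshock (g z h r : R) : R :=
  sqrt ((z - 1) * (fcurve g z h r - r - g * h ^ 2 / 2) / (z * h)).

Lemma fcurve_1 g h r : fcurve g 1 h r = r + g * h ^ 2 / 2.
Proof. unfold fcurve. destruct (Rle_dec 1 1); [field|lra]. Qed.

Lemma gshock_1 g h r : 0 < h -> gshock g 1 h r = 0.
Proof.
  intros Hh. unfold gshock. rewrite fcurve_1.
  replace ((1 - 1) * (r + g * h ^ 2 / 2 - r - g * h ^ 2 / 2) / (1 * h)) with 0 by (field; lra).
  apply sqrt_0.
Qed.

Lemma gshock_radicand_nonneg g z h r :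
  0 < g -> 0 < h -> 0 < r -> in02 z ->
  0 <= (z - 1) * (fcurve g z h r - r - g * h ^ 2 / 2) / (z * h).
Proof.
  intros Hg Hh Hr Hz. pose proof (fcurve_increasing g h r Hg Hh Hr) as Hi.
  pose proof (fcurve_1 g h r) as E1.
  assert (I1 : in02 1) by (unfold in02; lra).
  assert (0 < z * h) by (destruct Hz; nra).
  apply Rdiv_le_0_compat; auto.
  destruct (Rtotal_order z 1) as [L|[L|L]].
  - pose proof (Hi _ _ Hz I1 L) as L'. cbv beta in L'. nra.
  - subst; rewrite E1; right; ring.
  - pose proof (Hi _ _ I1 Hz L) as L'. cbv beta in L'. nra.
Qed.

Lemma gcurve_continuous g h r :
  0 < g -> 0 < h -> 0 < r -> continuous02 (fun z => gcurve g z h r).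
Proof.
  intros Hg Hh Hr z [Hz1 Hz2]. unfold gcurve.
  assert (Hc : 0 < r / h ^ 3) by (apply Rdiv_lt_0_compat; auto; apply pow_lt; auto).
  apply (continuity_pt_glue (fun z => afun g (z * h) (r / h ^ 3) - afun g h (r / h ^ 3))
          (fun z => gshock g z h r)).
  - rewrite gshock_1, Rmult_1_l by auto. ring.
  - assert (0 < Rmin z 1) by (apply Rmin_glb_lt; lra).
    apply continuity_pt_minus; [|apply continuity_pt_cst].
    apply (continuity_pt_comp (fun z => z * h) (fun x => afun g x (r / h ^ 3))).
    + cont_poly; auto.
    + apply afun_continuity_pt; auto. nra.
  - assert (I : in02 (Rmax z 1)).
    { pose proof (Rmax_l z 1). split; [lra|]. apply Rmax_lub_lt; lra. }
    unfold gshock.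
    apply (continuity_pt_comp
             (fun z => (z - 1) * (fcurve g z h r - r - g * h ^ 2 / 2) / (z * h)) sqrt).
    + apply continuity_pt_mult.
      * apply continuity_pt_mult; [cont_poly; auto|].
        repeat apply continuity_pt_minus; try apply continuity_pt_cst.
        apply fcurve_continuous, I.
      * cont_poly. destruct I; nra.
    + apply continuity_pt_sqrt. apply gshock_radicand_nonneg; auto.
Qed.

Lemma gcurve_increasing g h r :
  0 < g -> 0 < h -> 0 < r -> increasing02 (fun z => gcurve g z h r).
Proof.
  intros Hg Hh Hr. unfold gcurve.
  assert (Hc : 0 < r / h ^ 3) by (apply Rdiv_lt_0_compat; auto; apply pow_lt; auto).
  apply (increasing02_glue (fun z => afun g (z * h) (r / h ^ 3) - afun g h (r / h ^ 3))
          (fun z => gshock g z h r)).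
  - rewrite gshock_1, Rmult_1_l by auto. ring.
  - intros x y Hx L Hy. apply Rplus_lt_compat_r. apply afun_lt; auto; nra.
  - intros x y Hx L Hy.
    assert (Ix : in02 x) by (unfold in02; lra).
    assert (Iy : in02 y) by (unfold in02; lra).
    apply sqrt_lt_1_alt. split; [apply gshock_radicand_nonneg; auto|].
    pose proof (fcurve_increasing g h r Hg Hh Hr _ _ Ix Iy L) as L'. cbv beta in L'.
    assert (M1 : 0 <= fcurve g x h r - r - g * h ^ 2 / 2).
    { destruct (Req_dec x 1) as [->|N]; [rewrite fcurve_1; lra|].
      assert (I1 : in02 1) by (unfold in02; lra).
      assert (L1 : 1 < x) by lra.
      pose proof (fcurve_increasing g h r Hg Hh Hr _ _ I1 Ix L1) as L''. cbv beta in L''.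
      rewrite fcurve_1 in L''. lra. }
    (* In this form the radicand is a product of two nonnegative increasing factors. *)
    assert (E : forall z, 1 <= z -> (z - 1) * (fcurve g z h r - r - g * h ^ 2 / 2) / (z * h)
              = (1 - / z) * ((fcurve g z h r - r - g * h ^ 2 / 2) / h)).
    { intros z Hz. field. lra. }
    rewrite !E by lra.
    assert (Hinv : / y < / x) by (apply Rinv_lt_contravar; nra).
    assert (Hx1 : / x <= 1) by (rewrite <- Rinv_1; apply Rinv_le_contravar; lra).
    apply Rmult_le_0_lt_compat; try lra.
    + apply Rdiv_le_0_compat; auto.
    + apply Rmult_lt_compat_r; [apply Rinv_0_lt_compat; auto|lra].
Qed.

Lemma gcurve_onto g h r :
  0 < g -> 0 < h -> 0 < r -> onto02 (fun z => gcurve g z h r) (- afun g h (r / h ^ 3)).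
Proof.
  intros Hg Hh Hr.
  assert (Hc : 0 < r / h ^ 3) by (apply Rdiv_lt_0_compat; auto; apply pow_lt; auto).
  pose proof (afun_lt g (r / h ^ 3) 0 h Hg Hc (Rle_refl 0) Hh) as Ha.
  rewrite afun_0 in Ha.
  split.
  - intros x [Hx1 Hx2]. unfold gcurve. destruct (Rle_dec x 1).
    + assert (Hxh : 0 < x * h) by nra.
      pose proof (afun_lt g (r / h ^ 3) 0 (x * h) Hg Hc (Rle_refl 0) Hxh) as L.
      rewrite afun_0 in L. lra.
    + eapply Rlt_le_trans; [|apply sqrt_pos]. lra.
  - intros y Hy. apply (increasing_onto_bounds in02 (fun z => gcurve g z h r) y).
    + apply in02_convex.
    + apply gcurve_continuous; auto.
    + apply gcurve_increasing; auto.
    (* The margin of [y] above the infimum. As [afun] is continuous and zero at vacuum, a small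
       enough depth [x * h] keeps it below [e]. *)
    + set (e := y + afun g h (r / h ^ 3)).
      assert (He : 0 < e) by (unfold e; lra).
      destruct (afun_continuity_pt g (r / h ^ 3) 0 Hg Hc (Rle_refl 0) e He) as (d & Hd & HD).
      simpl in HD. unfold R_dist in HD.
      set (x := Rmin 1 (d / (2 * h))).
      assert (0 < d / (2 * h)) by (apply Rdiv_lt_0_compat; lra).
      pose proof (Rmin_l 1 (d / (2 * h))). pose proof (Rmin_r 1 (d / (2 * h))).
      assert (0 < x) by (apply Rmin_glb_lt; lra). fold x in H0, H1.
      exists x. split; [unfold in02; lra|].
      unfold gcurve. destruct (Rle_dec x 1); [|lra].
      assert (Hxh : x * h <= d / 2).
      { apply Rle_trans with (d / (2 * h) * h); [apply Rmult_le_compat_r; lra|].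
        right; field; lra. }
      assert (0 < x * h) by nra.
      assert (L : Rabs (afun g (x * h) (r / h ^ 3) - afun g 0 (r / h ^ 3)) < e).
      { apply HD. split; [split; [exact Logic.I|lra]|].
        rewrite Rminus_0_r, Rabs_pos_eq; lra. }
      rewrite afun_0 in L. apply Rabs_def2 in L. unfold e in L. lra.
    + set (k := Rmax y 1).
      pose proof (Rmax_l y 1) as Hk1. pose proof (Rmax_r y 1) as Hk2. fold k in Hk1, Hk2.
      (* The radicand at [2 - d], multiplied by [(2 - d) * h * d], is at least
         [(1 - d) ^ 2 * (3 * r)], hence at least [3 * r / 4]. The target [k ^ 2] becomes at most
         [2 * h * k ^ 2 * d], which gives the 8. Taking [k >= 1] keeps it positive whatever the sign
         of [y]. *)
      set (d := Rmin (1 / 2) (3 * r / (8 * h * k ^ 2))).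
      assert (Hk3 : 0 < k ^ 2) by (apply pow_lt; lra).
      assert (Hk4 : 0 < 8 * h * k ^ 2) by nra.
      assert (0 < 3 * r / (8 * h * k ^ 2)) by (apply Rdiv_lt_0_compat; lra).
      pose proof (Rmin_l (1 / 2) (3 * r / (8 * h * k ^ 2))).
      pose proof (Rmin_r (1 / 2) (3 * r / (8 * h * k ^ 2))).
      assert (0 < d) by (apply Rmin_glb_lt; lra). fold d in H0, H1.
      exists (2 - d). split; [unfold in02; lra|].
      unfold gcurve. destruct (Rle_dec (2 - d) 1); [lra|].
      apply Rle_trans with k; auto.
      rewrite <- (sqrt_pow2 k) by lra. apply sqrt_le_1_alt.
      unfold fcurve. destruct (Rle_dec (2 - d) 1); [lra|].
      fold (fshock g (2 - d) h r).
      rewrite fshock_excess by lra.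
      replace (2 - (2 - d)) with d by ring.
      assert (M : k ^ 2 * (8 * h * d) <= 3 * r).
      { apply Rle_trans with (k ^ 2 * (8 * h * (3 * r / (8 * h * k ^ 2)))).
        - apply Rmult_le_compat_l; [lra|]. apply Rmult_le_compat_l; lra.
        - right. field. lra. }
      assert (0 < g * h ^ 2) by (apply Rmult_lt_0_compat; auto; apply pow_lt; auto).
      apply Rmult_le_reg_r with ((2 - d) * h * d).
      { repeat apply Rmult_lt_0_compat; lra. }
      replace ((2 - d - 1) * ((2 - d - 1) *
         ((3 * r + g * h ^ 2 / 2 * (2 - d - 1) ^ 2) / d + g * h ^ 2 / 2 * (2 - d + 1)))
          / ((2 - d) * h) * ((2 - d) * h * d))
        with ((1 - d) ^ 2 * (3 * r + g * h ^ 2 * ((1 - d) ^ 2 / 2 + (3 - d) * d / 2)))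
        by (field; lra).
      assert (0 <= (1 - d) ^ 2 / 2 + (3 - d) * d / 2) by nra.
      assert (0 <= g * h ^ 2 * ((1 - d) ^ 2 / 2 + (3 - d) * d / 2))
        by (apply Rmult_le_pos; lra).
      assert (1 / 4 <= (1 - d) ^ 2) by nra.
      apply Rle_trans with (1 / 4 * (3 * r)).
      * assert (0 < k ^ 2 * (h * d)) by (repeat apply Rmult_lt_0_compat; lra). nra.
      * apply Rmult_le_compat; lra.
Qed.

(** * Shocks *)

Lemma posdef2_iff a b c : posdef2 a b c <-> 0 < a /\ 0 < a * c - b ^ 2.
Proof.
  unfold posdef2; split.
  - intros H.
    assert (Ha : 0 < a).
    { specialize (H 1 0). assert ((1, 0) <> (0, 0)) by (intros E; injection E; lra).
      specialize (H H0). lra. }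
    split; auto.
    (* At [(- b, a)] the form equals [a] times the determinant. *)
    specialize (H (- b) a).
    assert ((- b, a) <> (0, 0)) by (intros E; injection E; lra).
    specialize (H H0). apply Rmult_lt_reg_l with a; auto. lra.
  - intros [Ha Hd] x y N.
    apply Rmult_lt_reg_l with a; auto. rewrite Rmult_0_r.
    replace (a * (a * x ^ 2 + 2 * b * x * y + c * y ^ 2))
      with ((a * x + b * y) ^ 2 + (a * c - b ^ 2) * y ^ 2) by ring.
    pose proof (pow2_ge_0 (a * x + b * y)).
    destruct (Req_dec y 0) as [->|Ny].
    + assert (x <> 0) by (intros ->; apply N; reflexivity).
      replace ((a * x + b * 0) ^ 2 + (a * c - b ^ 2) * 0 ^ 2) with ((a * x) ^ 2) by ring.
      apply pow2_gt_0. apply Rmult_integral_contrapositive_currified; lra.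
    + assert (0 < y ^ 2) by (apply pow2_gt_0; auto). nra.
Qed.

(** The form used from here on, since the wave relations control [P11] and [detP] and not the
    quadratic form. *)
Lemma admissible_iff U : admissible U <-> 0 < depth U /\ 0 < P11 U /\ 0 < detP U.
Proof.
  unfold admissible. rewrite posdef2_iff. unfold R11, R12, R22, detP.
  split; intros (Hh & H1 & H2); split; auto.
  - split.
    + apply Rmult_lt_reg_l with (depth U); auto. lra.
    + apply Rmult_lt_reg_l with (depth U ^ 2); [apply pow_lt; auto|]. lra.
  - split.
    + apply Rmult_lt_0_compat; auto.
    + replace (depth U * P11 U * (depth U * P22 U) - (depth U * P12 U) ^ 2)
        with (depth U ^ 2 * (P11 U * P22 U - P12 U ^ 2)) by ring.
      apply Rmult_lt_0_compat; auto. apply pow_lt; auto.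
Qed.

Lemma state_ext U V :
  depth U = depth V -> vel1 U = vel1 V -> vel2 U = vel2 V ->
  P11 U = P11 V -> P12 U = P12 V -> P22 U = P22 V -> U = V.
Proof. destruct U, V; simpl; intros; subst; reflexivity. Qed.

Lemma P22_from_det U : P11 U <> 0 -> P22 U = (detP U + P12 U ^ 2) / P11 U.
Proof. intros. unfold detP. field. auto. Qed.

(** Conditions in the frame of the shock: [wA], [wB] are the relative velocities
    and [m] the mass flux.  Galilean invariance of the fourth and fifth conditions
    relies on the linear path. *)
Lemma rankine_hugoniot_frame g A B S wA wB m :
  wA = vel1 A - S -> wB = vel1 B - S -> m = depth A * wA ->
  rankine_hugoniot g A B S <->
  (depth B * wB = m /\
   m * wB + R11 B + g * depth B ^ 2 / 2 = m * wA + R11 A + g * depth A ^ 2 / 2 /\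
   R12 B + m * vel2 B = R12 A + m * vel2 A /\
   3 * R11 B * wB + m * wB ^ 2 + 2 * g * m * depth B
     = 3 * R11 A * wA + m * wA ^ 2 + 2 * g * m * depth A /\
   R12 B * wB + (R11 B + m * wB) * vel2 B / 2
     + g / 4 * (depth A * vel2 A + depth B * vel2 B) * (depth B - depth A)
     = R12 A * wA + (R11 A + m * wA) * vel2 A / 2 /\
   R22 B * wB + m * vel2 B ^ 2 + 2 * R12 B * vel2 B
     = R22 A * wA + m * vel2 A ^ 2 + 2 * R12 A * vel2 A).
Proof.
  intros EA EB Em. unfold rankine_hugoniot, jump, mean, mom1, mom2, E11, E12, E22.
  generalize (R11 A) (R11 B) (R12 A) (R12 B) (R22 A) (R22 B).
  generalize dependent (depth A). generalize dependent (depth B).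
  generalize (vel2 A) (vel2 B).
  assert (EA' : vel1 A = wA + S) by lra. assert (EB' : vel1 B = wB + S) by lra.
  rewrite EA', EB'. clear.
  intros va vb hb ha Em ra rb qa qb ta tb. subst m.
  split.
  - intros (H1 & H2 & H3 & H4 & H5 & H6).
    assert (K1 : hb * wB = ha * wA) by lra.
    assert (K2 : ha * wA * wB + rb + g * hb ^ 2 / 2 = ha * wA * wA + ra + g * ha ^ 2 / 2).
    { rewrite <- K1 at 1.
      assert (S * (hb * wB - ha * wA) = 0) by (rewrite K1; ring). lra. }
    assert (K3 : qb + ha * wA * vb = qa + ha * wA * va) by (rewrite <- K1 at 1; lra).
    (* Change of frame: the energy balances differ from their moving-frame versions by multiples of
       the mass and momentum balances. The [T] facts supply these products, after which the goals
       are linear in the monomials. *)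
    assert (T1 : S * (hb * wB - ha * wA) = 0) by (rewrite K1; ring).
    assert (T1' : S * S * (hb * wB - ha * wA) = 0) by (rewrite K1; ring).
    assert (T2 : S * (rb + hb * wB * wB + g * hb ^ 2 / 2 - (ra + ha * wA * wA + g * ha ^ 2 / 2)) = 0)
      by (rewrite K1; replace (rb + ha * wA * wB + g * hb ^ 2 / 2) with
        (ha * wA * wB + rb + g * hb ^ 2 / 2) by ring; rewrite K2; ring).
    assert (T3 : S * (qb + hb * wB * vb - (qa + ha * wA * va)) = 0)
      by (rewrite K1, K3; ring).
    repeat split; auto.
    + assert (T4 : (hb * wB - ha * wA) * wB ^ 2 = 0) by (rewrite K1; ring).
      assert (T5 : (hb * wB - ha * wA) * g * (hb - ha) = 0) by (rewrite K1; ring).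
      lra.
    + assert (T4 : (hb * wB - ha * wA) * wB * vb = 0) by (rewrite K1; ring).
      lra.
    + assert (T4 : (hb * wB - ha * wA) * vb ^ 2 = 0) by (rewrite K1; ring).
      lra.
  - intros (K1 & K2 & K3 & K4 & K5 & K6).
    assert (T1 : S * (hb * wB - ha * wA) = 0) by (rewrite K1; ring).
    assert (T1' : S * S * (hb * wB - ha * wA) = 0) by (rewrite K1; ring).
    assert (T2 : S * (rb + hb * wB * wB + g * hb ^ 2 / 2 - (ra + ha * wA * wA + g * ha ^ 2 / 2)) = 0)
      by (rewrite K1; replace (rb + ha * wA * wB + g * hb ^ 2 / 2) with
        (ha * wA * wB + rb + g * hb ^ 2 / 2) by ring; rewrite K2; ring).
    assert (T3 : S * (qb + hb * wB * vb - (qa + ha * wA * va)) = 0)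
      by (rewrite K1, K3; ring).
    assert (T4 : (hb * wB - ha * wA) * wB ^ 2 = 0) by (rewrite K1; ring).
    assert (T5 : (hb * wB - ha * wA) * g * (hb - ha) = 0) by (rewrite K1; ring).
    assert (T6 : (hb * wB - ha * wA) * wB * vb = 0) by (rewrite K1; ring).
    assert (T7 : (hb * wB - ha * wA) * vb ^ 2 = 0) by (rewrite K1; ring).
    assert (T8 : (hb * wB - ha * wA) * wB = 0) by (rewrite K1; ring).
    assert (T9 : (hb * wB - ha * wA) * vb = 0) by (rewrite K1; ring).
    repeat split; lra.
Qed.

(** The velocity of [A] relative to the 1-shock with depth ratio [z]. *)
Definition shock_flow g A z : R :=
  sqrt (z * (6 * P11 A + g * depth A * (3 - z)) / (2 * (2 - z))).

(** The result of eliminating the relative velocities between the momentum and energy balances. The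
    factor [2 - z] in the denominator is what rules out depth ratios of 2 or more. *)
Definition shock_P11 g A z : R :=
  (P11 A * (2 * z - 1) + g * depth A / 2 * (z - 1) ^ 3) / (z * (2 - z)).

(** The transverse balances amount to the conservation of [shear_ratio], as for rarefactions. *)
Definition shock_state g A z : state :=
  let s := shear_ratio g A in
  let d := shock_flow g A z * (z - 1) / z in
  mkState (z * depth A) (vel1 A - d) (vel2 A - 2 * s * d) (shock_P11 g A z)
    (s * (g * (z * depth A) + 2 * shock_P11 g A z))
    (P22 A + 4 * s ^ 2 * d ^ 2 + 4 * P12 A * s * ((z - 1) / z)).

Lemma shock_flow_sqr g A z : 0 < g -> admissible A -> 1 < z < 2 ->
  0 < shock_flow g A z /\
  2 * (2 - z) * shock_flow g A z ^ 2 = z * (6 * P11 A + g * depth A * (3 - z)).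
Proof.
  intros hg hA Hz. apply admissible_iff in hA as (Hh & HP & _).
  set (h := depth A) in *. set (P := P11 A) in *.
  assert (N : 0 < z * (6 * P + g * h * (3 - z)) / (2 * (2 - z))).
  { apply Rdiv_lt_0_compat; [|lra]. apply Rmult_lt_0_compat; [lra|].
    assert (0 < g * h) by nra. nra. }
  unfold shock_flow. fold h P. split; [apply sqrt_lt_R0; auto|].
  rewrite pow2_sqrt by lra. field. lra.
Qed.

Lemma shock_flow_unique g A z w : 1 < z < 2 -> 0 < w ->
  2 * (2 - z) * w ^ 2 = z * (6 * P11 A + g * depth A * (3 - z)) -> w = shock_flow g A z.
Proof.
  intros Hz Hw E. unfold shock_flow. rewrite <- E.
  replace (2 * (2 - z) * w ^ 2 / (2 * (2 - z))) with (w ^ 2) by (field; lra).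
  rewrite sqrt_pow2; lra.
Qed.

Lemma shock_P11_pos g A z : 0 < g -> admissible A -> 1 < z < 2 -> 0 < shock_P11 g A z.
Proof.
  intros hg hA Hz. apply admissible_iff in hA as (Hh & HP & _).
  unfold shock_P11.
  set (h := depth A) in *. set (P := P11 A) in *. apply Rdiv_lt_0_compat; [|nra].
  assert (0 < (z - 1) ^ 3) by (apply pow_lt; lra).
  assert (0 < g * h / 2) by nra. nra.
Qed.

Lemma shock1_inv g A B S : 0 < g -> admissible A -> admissible B -> shock1 g A B S ->
  exists z, 1 < z < 2 /\ B = shock_state g A z /\ S = vel1 A - shock_flow g A z.
Proof.
  intros hg hA hB (RH & L1 & L2). pose proof hA as hA'.
  apply admissible_iff in hA' as (Hh & HP & _).
  apply admissible_iff in hB as (HhB & HPB & _).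
  unfold lambda1 in L1, L2.
  set (h := depth A) in *. set (P := P11 A) in *.
  set (w := vel1 A - S). set (k := vel1 B - S).
  apply (rankine_hugoniot_frame g A B S w k (h * w)) in RH; auto.
  destruct RH as (K1 & K2 & K3 & K4 & K5 & K6).
  unfold R11, R12, R22 in *. fold h P in K1, K2, K3, K4, K5, K6.
  set (z := depth B / h).
  assert (EhB : depth B = z * h) by (unfold z; field; lra).
  assert (Hz0 : 0 < z) by (unfold z; apply Rdiv_lt_0_compat; auto).
  assert (Hgh : 0 < g * h) by nra.
  assert (HghB : 0 < g * depth B) by nra.
  rewrite EhB in *. clearbody z.
  set (P' := P11 B) in *.
  assert (Hw : sqrt (g * h + 3 * P) < w) by (unfold w; lra).
  assert (Hk : k < sqrt (g * (z * h) + 3 * P')) by (unfold k; lra).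
  pose proof (sqrt_pos (g * h + 3 * P)).
  assert (Hw0 : 0 < w) by lra.
  assert (Hw2 : g * h + 3 * P < w ^ 2).
  { rewrite <- (pow2_sqrt (g * h + 3 * P)) by lra. apply pow_lt_incr; lra. }
  assert (Ewk : w = z * k) by (apply Rmult_eq_reg_l with h; lra).
  assert (Hk0 : 0 < k) by nra.
  assert (Hk2 : k ^ 2 < g * (z * h) + 3 * P').
  { rewrite <- (pow2_sqrt (g * (z * h) + 3 * P')) by lra. apply pow_lt_incr; lra. }
  (* momentum and energy balance, divided by [h] and by [h * w] *)
  assert (M2 : z * k ^ 2 * (1 - z) + z * P' - P + g * h * (z ^ 2 - 1) / 2 = 0).
  { apply Rmult_eq_reg_l with h; [|lra]. rewrite Ewk in K2. lra. }
  assert (M4 : 3 * (P' - P) + k ^ 2 * (1 - z ^ 2) + 2 * g * h * (z - 1) = 0).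
  { apply Rmult_eq_reg_l with (h * w); [|nra]. rewrite Ewk in *. lra. }
  (* [1 + z] times the momentum balance minus [z] times the energy balance is free of [k ^ 2]. *)
  assert (EP : z * (2 - z) * P' = P * (2 * z - 1) + g * h / 2 * (z - 1) ^ 3).
  { assert (z * (3 * (P' - P) + k ^ 2 * (1 - z ^ 2) + 2 * g * h * (z - 1)) = 0)
      by (rewrite M4; ring).
    assert ((1 + z) * (z * k ^ 2 * (1 - z) + z * P' - P + g * h * (z ^ 2 - 1) / 2) = 0)
      by (rewrite M2; ring).
    lra. }
  assert (Hz2 : z < 2).
  { destruct (Rlt_or_le z 2) as [|C]; auto. exfalso.
    assert (0 < (z - 1) ^ 3) by (apply pow_lt; lra).
    assert (0 < z * P') by nra.
    assert (0 < P * (2 * z - 1)) by nra.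
    assert (0 < g * h / 2 * (z - 1) ^ 3) by nra.
    nra. }
  (* Eliminating [P'] by [EP] splits off [z - 1]. If that factor vanishes then [k = w] and [P' = P],
     and the two Lax inequalities contradict each other. *)
  assert (Fac : (z - 1) * (6 * P + g * h * (3 - z) - 2 * (2 - z) * z * k ^ 2) = 0).
  { assert (2 * (2 - z) * (z * k ^ 2 * (1 - z) + z * P' - P + g * h * (z ^ 2 - 1) / 2) = 0)
      by (rewrite M2; ring).
    lra. }
  apply Rmult_integral in Fac as [Fac|Fac].
  { exfalso. assert (z = 1) by lra. subst z. clear - Hw2 Hk2 EP Ewk.
    replace w with k in * by lra. lra. }
  assert (Ew : 2 * (2 - z) * w ^ 2 = z * (6 * P + g * h * (3 - z))).
  { rewrite Ewk. replace (2 * (2 - z) * (z * k) ^ 2) with (z * (2 * (2 - z) * z * k ^ 2)) by ring.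
    f_equal. lra. }
  (* With [w ^ 2] known, the Lax inequality ahead of the shock says that
     [(z - 1) * (12 * P + g * h * (4 - z))] is positive. *)
  assert (Hz1 : 1 < z).
  { assert (2 * (2 - z) * (g * h + 3 * P) < 2 * (2 - z) * w ^ 2)
      by (apply Rmult_lt_compat_l; lra).
    rewrite Ew in H0.
    assert (0 < (z - 1) * (12 * P + g * h * (4 - z))) by lra.
    assert (0 < 12 * P + g * h * (4 - z)) by nra. nra. }
  assert (Hz : 1 < z < 2) by lra.
  assert (Efl : w = shock_flow g A z) by (apply shock_flow_unique; auto).
  assert (Ek : k = w / z) by (rewrite Ewk; field; lra).
  assert (EP' : P' = shock_P11 g A z).
  { unfold shock_P11. fold h P. rewrite <- EP. field. lra. }
  exists z. split; auto. split; [|unfold w in Efl; lra].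
  set (s := shear_ratio g A).
  assert (Es : P12 A = s * (g * h + 2 * P)).
  { unfold s, shear_ratio. fold h P. field. lra. }
  assert (Ev : vel2 B = vel2 A - 2 * s * (w * (z - 1) / z)).
  { (* the transverse momentum flux times [k] cancels [P12 B] *)
    set (dv := vel2 B - vel2 A).
    assert (N3 : z * P12 B = P12 A - w * dv).
    { apply Rmult_eq_reg_l with h; [|lra]. unfold dv. lra. }
    assert (N5 : P12 A * (k - w) = dv / 2 * (2 * P + g * h)).
    { assert (T : z * P12 B * k - P12 A * w + (z * P' + w * k) * vel2 B / 2
          - (P + w * w) * vel2 A / 2 + g * h / 4 * (vel2 A + z * vel2 B) * (z - 1) = 0).
      { apply Rmult_eq_reg_l with h; [|lra]. lra. }
      rewrite N3 in T. unfold dv in *.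
      assert (T2 : (z * k ^ 2 * (1 - z) + z * P' - P + g * h * (z ^ 2 - 1) / 2) * (vel2 A / 2) = 0)
        by (rewrite M2; ring).
      (* By [Fac] and [EP] the bracket is zero. This evaluates the coefficient of the jump of [vel2]
         in the transverse energy balance and leaves the factor [2 * P + g * h], the denominator of
         the shear ratio. *)
      assert (T3 : (z * k ^ 2 - z * P' - g * h * z * (z - 1) / 2 - 2 * P - g * h) * 2 * (2 - z)
          = 0).
      { lra. }
      apply Rmult_integral in T3 as [T3|T3]; [|lra].
      apply Rmult_integral in T3 as [T3|T3]; [|lra].
      assert (T4 : (z * k ^ 2 - z * P' - g * h * z * (z - 1) / 2 - 2 * P - g * h)
          * ((vel2 B - vel2 A) / 2) = 0) by (rewrite T3; ring).
      rewrite Ewk in *. lra. }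
    rewrite Es in N5.
    assert (Q : dv = 2 * s * (k - w)).
    { apply Rmult_eq_reg_r with ((2 * P + g * h) / 2); lra. }
    unfold dv in Q. rewrite Ek in Q.
    replace (w / z - w) with (- (w * (z - 1) / z)) in Q by (field; lra). lra. }
  assert (EP12 : P12 B = s * (g * (z * h) + 2 * P')).
  { assert (N3 : z * P12 B = P12 A - w * (vel2 B - vel2 A)).
    { apply Rmult_eq_reg_l with h; [|lra]. lra. }
    rewrite Ev, Es in N3.
    apply Rmult_eq_reg_l with (z * (2 - z)); [|nra].
    replace (z * (2 - z) * P12 B) with ((2 - z) * (z * P12 B)) by ring. rewrite N3.
    replace ((2 - z) * (s * (g * h + 2 * P) - w * (vel2 A - 2 * s * (w * (z - 1) / z) - vel2 A)))
      with ((2 - z) * s * (g * h + 2 * P) + s * (z - 1) / z * (2 * (2 - z) * w ^ 2))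
      by (field; lra).
    rewrite Ew.
    replace (z * (2 - z) * (s * (g * (z * h) + 2 * P')))
      with (s * (z * (2 - z) * g * z * h + 2 * (z * (2 - z) * P'))) by ring.
    rewrite EP. field. lra. }
  assert (EP22 : P22 B = P22 A + 4 * s ^ 2 * (w * (z - 1) / z) ^ 2 + 4 * P12 A * s * ((z - 1) / z)).
  { assert (N3 : z * P12 B = P12 A - w * (vel2 B - vel2 A)).
    { apply Rmult_eq_reg_l with h; [|lra]. lra. }
    assert (N6 : w * P22 B + w * vel2 B ^ 2 + 2 * (z * P12 B) * vel2 B
                 = w * P22 A + w * vel2 A ^ 2 + 2 * P12 A * vel2 A).
    { apply Rmult_eq_reg_l with h; [|lra]. rewrite Ewk in *. lra. }
    rewrite N3, Ev in N6.
    apply Rmult_eq_reg_l with w; [|lra].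
    replace (w * (P22 A + 4 * s ^ 2 * (w * (z - 1) / z) ^ 2 + 4 * P12 A * s * ((z - 1) / z)))
      with (w * P22 A + 4 * w * s ^ 2 * (w * (z - 1) / z) ^ 2
            + 4 * P12 A * s * (w * (z - 1) / z)) by (field; lra).
    lra. }
  apply state_ext; simpl; rewrite <- ?Efl, <- ?EP'; fold h P s; auto.
  assert (vel1 B = vel1 A - w + w / z) by (unfold w, k in *; lra).
  replace (w * (z - 1) / z) with (w - w / z) by (field; lra). lra.
Qed.

Ltac simpl_state := unfold shock_state; cbn [depth vel1 vel2 P11 P12 P22].

Lemma shock_P11_eq g A z : 1 < z < 2 ->
  z * (2 - z) * shock_P11 g A z = P11 A * (2 * z - 1) + g * depth A / 2 * (z - 1) ^ 3.
Proof. intros Hz. unfold shock_P11. field. lra. Qed.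

Lemma shear_ratio_eq g A : 0 < g -> admissible A ->
  P12 A = shear_ratio g A * (g * depth A + 2 * P11 A).
Proof.
  intros hg hA. apply admissible_iff in hA as (Hh & HP & _).
  unfold shear_ratio. field. nra.
Qed.

(** Substituting [P22 > P12 ^ 2 / P11] in the determinant behind the shock leaves
    [s ^ 2] times a quantity which, multiplied by [P11 * (z * (2 - z)) ^ 2], equals
    [G ^ 2 * t ^ 3 * (1 - t ^ 2) * (P11 * (2 + t) + G / 2)], where [s] is the shear
    ratio, [G = g h] and [t = z - 1]. *)
Lemma shock_state_admissible g A z : 0 < g -> admissible A -> 1 < z < 2 ->
  admissible (shock_state g A z).
Proof.
  intros hg hA Hz.
  pose proof (shock_P11_pos g A z hg hA Hz) as HP'.
  pose proof (shock_P11_eq g A z Hz) as EP'.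
  destruct (shock_flow_sqr g A z hg hA Hz) as [Hw Ew].
  pose proof (shear_ratio_eq g A hg hA) as Es.
  apply admissible_iff in hA as (Hh & HP & HD).
  apply admissible_iff. unfold detP in *. simpl_state. split; [nra|]. split; auto.
  set (s := shear_ratio g A) in *. set (P' := shock_P11 g A z) in *.
  set (w := shock_flow g A z) in *. set (P := P11 A) in *.
  assert (HG : 0 < g * depth A) by nra.
  replace (g * (z * depth A)) with (g * depth A * z) by ring.
  set (G := g * depth A) in *. clearbody s P' w P G.
  set (Q := P12 A) in *. set (N := P22 A) in *. clearbody Q N. subst Q.
  set (y := z * (2 - z)) in *. assert (Hy : 0 < y) by (unfold y; nra).
  assert (HN : 0 < P * N - (s * (G + 2 * P)) ^ 2) by lra.
  assert (Hyy : 0 < P * y ^ 2) by (apply Rmult_lt_0_compat; [lra|apply pow_lt; lra]).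
  apply Rmult_lt_reg_l with (P * y ^ 2); auto.
  rewrite Rmult_0_r.
  set (X := P * (2 * z - 1) + G / 2 * (z - 1) ^ 3) in *.
  assert (Ed : y * (w * (z - 1) / z) ^ 2 = (6 * P + G * (3 - z)) * (z - 1) ^ 2 / 2).
  { unfold y. replace (z * (2 - z) * (w * (z - 1) / z) ^ 2)
      with (2 * (2 - z) * w ^ 2 * (z - 1) ^ 2 / (2 * z)) by (field; lra).
    rewrite Ew. field. lra. }
  set (d := w * (z - 1) / z) in *. clearbody d.
  replace (P * y ^ 2 * (P' * (N + 4 * s ^ 2 * d ^ 2 + 4 * (s * (G + 2 * P)) * s * ((z - 1) / z))
     - (s * (G * z + 2 * P')) ^ 2))
   with ((y * P') * y * (P * N)
     + s ^ 2 * P * ((y * P') * (4 * (y * d ^ 2) + 4 * (G + 2 * P) * (y * ((z - 1) / z)))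
        - (G * z * y + 2 * (y * P')) ^ 2)) by ring.
  rewrite EP', Ed.
  replace (y * ((z - 1) / z)) with ((2 - z) * (z - 1)) by (unfold y; field; lra).
  assert (HX : 0 < X) by (rewrite <- EP'; apply Rmult_lt_0_compat; auto).
  replace (X * y * (P * N) +
    s ^ 2 * P * (X * (4 * ((6 * P + G * (3 - z)) * (z - 1) ^ 2 / 2)
       + 4 * (G + 2 * P) * ((2 - z) * (z - 1))) - (G * z * y + 2 * X) ^ 2))
   with (X * y * (P * N - (s * (G + 2 * P)) ^ 2)
    + s ^ 2 * (G ^ 2 * (z - 1) ^ 3 * y * (P * (z + 1) + G / 2)))
    by (unfold X, y; field).
  apply Rplus_lt_le_0_compat.
  - apply Rmult_lt_0_compat; auto. apply Rmult_lt_0_compat; auto.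
  - apply Rmult_le_pos; [apply pow2_ge_0|].
    assert (0 < (z - 1) ^ 3) by (apply pow_lt; lra).
    assert (0 < P * (z + 1)) by nra.
    assert (0 < G ^ 2) by (apply pow_lt; lra).
    left. apply Rmult_lt_0_compat; [|lra]. apply Rmult_lt_0_compat; auto.
    apply Rmult_lt_0_compat; auto.
Qed.

Lemma shock_state_shock1 g A z : 0 < g -> admissible A -> 1 < z < 2 ->
  shock1 g A (shock_state g A z) (vel1 A - shock_flow g A z).
Proof.
  intros hg hA Hz.
  pose proof (shock_P11_pos g A z hg hA Hz) as HP'.
  pose proof (shock_P11_eq g A z Hz) as EP'.
  destruct (shock_flow_sqr g A z hg hA Hz) as [Hw Ew].
  pose proof (shear_ratio_eq g A hg hA) as Es.
  apply admissible_iff in hA as (Hh & HP & HD).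
  set (h := depth A) in *. set (P := P11 A) in *.
  set (s := shear_ratio g A) in *. set (P' := shock_P11 g A z) in *.
  assert (HG : 0 < g * h) by nra.
  split; [|split].
  - apply (rankine_hugoniot_frame g A _ _ (shock_flow g A z) (shock_flow g A z / z)
             (h * shock_flow g A z)).
    + lra.
    + simpl_state. field. lra.
    + reflexivity.
    + unfold R11, R12, R22. simpl_state. fold h P s P'. rewrite Es.
      set (w := shock_flow g A z) in *. set (va := vel2 A). set (N := P22 A).
      assert (EP2 : P' = (P * (2 * z - 1) + g * h / 2 * (z - 1) ^ 3) / (z * (2 - z)))
        by reflexivity.
      (* [w] is a square root, so each balance is first rearranged until, apart from a common factor
         [w], only [w ^ 2] occurs; substituting [Ew2] and [EP2] then leaves a rational identity. *)
      assert (Ew2 : w ^ 2 = z * (6 * P + g * h * (3 - z)) / (2 * (2 - z)))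
        by (rewrite <- Ew; field; lra).
      clearbody w s P' va N h P.
      repeat split.
      * field. lra.
      * replace (h * w * (w / z) + z * h * P' + g * (z * h) ^ 2 / 2)
          with (h * w ^ 2 / z + z * h * P' + g * (z * h) ^ 2 / 2) by (field; lra).
        replace (h * w * w) with (h * w ^ 2) by ring.
        rewrite Ew2, EP2. field. lra.
      * replace (h * w * (va - 2 * s * (w * (z - 1) / z)))
          with (h * w * va - 2 * h * s * (w ^ 2 * (z - 1) / z)) by (field; lra).
        rewrite Ew2, EP2. field. lra.
      * replace (3 * (z * h * P') * (w / z) + h * w * (w / z) ^ 2 + 2 * g * (h * w) * (z * h))
          with (h * w * (3 * P' + w ^ 2 / z ^ 2 + 2 * g * z * h)) by (field; lra).
        replace (3 * (h * P) * w + h * w * w ^ 2 + 2 * g * (h * w) * h)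
          with (h * w * (3 * P + w ^ 2 + 2 * g * h)) by ring.
        rewrite Ew2, EP2. field. lra.
      * replace (z * h * (s * (g * (z * h) + 2 * P')) * (w / z) +
           (z * h * P' + h * w * (w / z)) * (va - 2 * s * (w * (z - 1) / z)) / 2 +
           g / 4 * (h * va + z * h * (va - 2 * s * (w * (z - 1) / z))) * (z * h - h))
         with (w * s * h * ((g * (z * h) + 2 * P') - (z * P' + w ^ 2 / z) * (z - 1) / z
                - g * h * (z - 1) ^ 2 / 2)
            + va * h * ((z * P' + w ^ 2 / z) / 2 + g / 4 * h * (1 + z) * (z - 1)))
          by (field; lra).
        replace (h * (s * (g * h + 2 * P)) * w + (h * P + h * w * w) * va / 2)
         with (w * s * h * (g * h + 2 * P) + va * h * ((P + w ^ 2) / 2)) by field.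
        rewrite Ew2, EP2. field. lra.
      * replace (z * h * (N + 4 * s ^ 2 * (w * (z - 1) / z) ^ 2 +
           4 * (s * (g * h + 2 * P)) * s * ((z - 1) / z)) * (w / z) +
          h * w * (va - 2 * s * (w * (z - 1) / z)) ^ 2 +
          2 * (z * h * (s * (g * (z * h) + 2 * P'))) * (va - 2 * s * (w * (z - 1) / z)))
         with (h * w * N + h * w * va ^ 2
            + w * h * s ^ 2 * (8 * w ^ 2 * ((z - 1) / z) ^ 2
               + 4 * (g * h + 2 * P) * ((z - 1) / z)
               - 4 * (g * (z * h) + 2 * P') * (z - 1))
            + va * s * h * (2 * z * (g * (z * h) + 2 * P') - 4 * w ^ 2 * (z - 1) / z))
          by (field; lra).
        rewrite Ew2, EP2. field. lra.
  - unfold lambda1. apply Rlt_gt. fold h P.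
    apply Rplus_lt_compat_l, Ropp_lt_contravar.
    rewrite <- (sqrt_pow2 (shock_flow g A z)) by lra.
    apply sqrt_lt_1_alt. split; [lra|].
    apply Rmult_lt_reg_l with (2 * (2 - z)); [lra|]. rewrite Ew.
    assert (0 < (z - 1) * (12 * P + g * h * (4 - z))).
    { apply Rmult_lt_0_compat; [lra|]. nra. }
    lra.
  - unfold lambda1. simpl_state. apply Rlt_gt. fold h P P'.
    set (w := shock_flow g A z) in *.
    replace (vel1 A - w * (z - 1) / z) with (vel1 A - w + w / z) by (field; lra).
    cut (w / z < sqrt (g * (z * h) + 3 * P')); [lra|].
    assert (0 < w / z) by (apply Rdiv_lt_0_compat; lra).
    rewrite <- (sqrt_pow2 (w / z)) by lra.
    apply sqrt_lt_1_alt. split; [apply pow2_ge_0|].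
    apply Rmult_lt_reg_l with (2 * z * (2 - z)); [nra|].
    replace (2 * z * (2 - z) * (w / z) ^ 2) with (2 * (2 - z) * w ^ 2 / z) by (field; lra).
    rewrite Ew.
    replace (z * (6 * P + g * h * (3 - z)) / z) with (6 * P + g * h * (3 - z)) by (field; lra).
    (* By [EP'] the difference of the two sides is [12 * (z - 1) * P + g * h * (z - 1) * ((z - 2) ^
       2 + 2)]. *)
    assert (0 < (z - 1) * P) by (apply Rmult_lt_0_compat; lra).
    assert (0 < g * h * ((z - 1) * ((z - 2) ^ 2 + 2))).
    { apply Rmult_lt_0_compat; auto. apply Rmult_lt_0_compat; [lra|].
      pose proof (pow2_ge_0 (z - 2)). lra. }
    lra.
Qed.

(** Needed to order the waves. Behind the shock the relative velocity is [w / z], and it exceeds the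
    square root of [P11] there because [z < 2]. *)
Lemma shock_state_lambda2 g A z : 0 < g -> admissible A -> 1 < z < 2 ->
  vel1 A - shock_flow g A z < lambda2 (shock_state g A z).
Proof.
  intros hg hA Hz.
  pose proof (shock_P11_pos g A z hg hA Hz) as HP'.
  pose proof (shock_P11_eq g A z Hz) as EP'.
  destruct (shock_flow_sqr g A z hg hA Hz) as [Hw Ew].
  apply admissible_iff in hA as (Hh & HP & _).
  unfold lambda2. simpl_state.
  set (h := depth A) in *. set (P := P11 A) in *.
  set (P' := shock_P11 g A z) in *. set (w := shock_flow g A z) in *.
  assert (HG : 0 < g * h) by nra.
  replace (vel1 A - w * (z - 1) / z) with (vel1 A - w + w / z) by (field; lra).
  cut (sqrt P' < w / z); [lra|].
  assert (0 < w / z) by (apply Rdiv_lt_0_compat; lra).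
  rewrite <- (sqrt_pow2 (w / z)) by lra.
  apply sqrt_lt_1_alt. split; [lra|].
  apply Rmult_lt_reg_l with (2 * z * (2 - z)); [nra|].
  replace (2 * z * (2 - z) * (w / z) ^ 2) with (2 * (2 - z) * w ^ 2 / z) by (field; lra).
  rewrite Ew.
  replace (z * (6 * P + g * h * (3 - z)) / z) with (6 * P + g * h * (3 - z)) by (field; lra).
  replace (2 * z * (2 - z) * P') with (2 * (z * (2 - z) * P')) by ring. rewrite EP'.
  assert (0 < P * (8 - 4 * z)) by nra.
  assert (0 < (3 - z) - (z - 1) ^ 3).
  { replace ((3 - z) - (z - 1) ^ 3) with ((2 - z) * (1 + (1 + (z - 1) + (z - 1) ^ 2)))
      by ring.
    pose proof (pow2_ge_0 (z - 1)). apply Rmult_lt_0_compat; lra. }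
  assert (0 < g * h * ((3 - z) - (z - 1) ^ 3)) by (apply Rmult_lt_0_compat; auto).
  lra.
Qed.

Lemma shock_state_total_pressure g A z : 1 < z < 2 ->
  R11 (shock_state g A z) + g * depth (shock_state g A z) ^ 2 / 2
  = fcurve g z (depth A) (R11 A).
Proof.
  intros Hz. unfold fcurve. destruct (Rle_dec z 1); [lra|].
  unfold R11, shock_P11. simpl_state. unfold shock_P11. field. lra.
Qed.

Lemma shock_state_vel1 g A z : 0 < g -> admissible A -> 1 < z < 2 ->
  vel1 (shock_state g A z) = vel1 A - gcurve g z (depth A) (R11 A).
Proof.
  intros hg hA Hz. destruct (shock_flow_sqr g A z hg hA Hz) as [Hw Ew].
  apply admissible_iff in hA as (Hh & HP & _).
  simpl_state. f_equal. unfold gcurve. destruct (Rle_dec z 1); [lra|].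
  assert (0 <= shock_flow g A z * (z - 1) / z) by (apply Rdiv_le_0_compat; nra).
  rewrite <- (sqrt_pow2 (shock_flow g A z * (z - 1) / z)) by auto.
  f_equal. f_equal.
  unfold fcurve. destruct (Rle_dec z 1); [lra|].
  fold (fshock g z (depth A) (R11 A)). rewrite fshock_excess by lra. unfold R11.
  replace ((shock_flow g A z * (z - 1) / z) ^ 2)
    with (2 * (2 - z) * shock_flow g A z ^ 2 * (z - 1) ^ 2 / (2 * (2 - z) * z ^ 2))
    by (field; lra).
  rewrite Ew. field. lra.
Qed.

(** * Rarefactions *)

Definition rare_afun g A z : R := afun g (z * depth A) (P11 A / depth A ^ 2).

Definition rare_state g A z : state :=
  let s := shear_ratio g A in
  let d := rare_afun g A z - afun_st g A in
  let p12 := s * (g * (z * depth A) + 2 * (z ^ 2 * P11 A)) in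
  mkState (z * depth A) (vel1 A - d) (vel2 A - 2 * s * d) (z ^ 2 * P11 A) p12
    ((z ^ 2 * detP A + p12 ^ 2) / (z ^ 2 * P11 A)).

Ltac simpl_rare := unfold rare_state; cbn [depth vel1 vel2 P11 P12 P22].

Lemma rare_state_detP g A z : admissible A -> 0 < z -> detP (rare_state g A z) = z ^ 2 * detP A.
Proof.
  intros hA Hz. apply admissible_iff in hA as (Hh & HP & _).
  unfold detP at 1. simpl_rare. field. lra.
Qed.

Lemma rare_state_admissible g A z : admissible A -> 0 < z -> admissible (rare_state g A z).
Proof.
  intros hA Hz. apply admissible_iff. rewrite rare_state_detP by auto.
  apply admissible_iff in hA as (Hh & HP & HD). simpl_rare.
  assert (0 < z ^ 2) by (apply pow_lt; auto).
  repeat split; apply Rmult_lt_0_compat; auto.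
Qed.

Lemma rare_state_shear_ratio g A z : 0 < g -> admissible A -> 0 < z ->
  shear_ratio g (rare_state g A z) = shear_ratio g A.
Proof.
  intros hg hA Hz. apply admissible_iff in hA as (Hh & HP & HD).
  unfold shear_ratio at 1. simpl_rare.
  assert (0 < z ^ 2 * P11 A) by (apply Rmult_lt_0_compat; auto; apply pow_lt; auto).
  assert (0 < g * (z * depth A)) by (repeat apply Rmult_lt_0_compat; auto).
  field. lra.
Qed.

Lemma rare_state_ratio g A z : admissible A -> 0 < z ->
  P11 (rare_state g A z) / depth (rare_state g A z) ^ 2 = P11 A / depth A ^ 2.
Proof.
  intros hA Hz. apply admissible_iff in hA as (Hh & HP & HD).
  simpl_rare. field. lra.
Qed.

Lemma rare_state_afun_st g A z : admissible A -> 0 < z ->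
  afun_st g (rare_state g A z) = rare_afun g A z.
Proof. intros. unfold afun_st. rewrite rare_state_ratio by auto. reflexivity. Qed.

Lemma rare_state_1 g A : 0 < g -> admissible A -> rare_state g A 1 = A.
Proof.
  intros hg hA. pose proof (shear_ratio_eq g A hg hA) as Es.
  apply admissible_iff in hA as (Hh & HP & HD).
  assert (Ed : rare_afun g A 1 - afun_st g A = 0)
    by (unfold rare_afun, afun_st; rewrite Rmult_1_l; ring).
  assert (E12 : shear_ratio g A * (g * (1 * depth A) + 2 * (1 ^ 2 * P11 A)) = P12 A)
    by (rewrite Es; ring).
  apply state_ext; simpl_rare; rewrite ?Ed, ?E12; try ring.
  unfold detP. field. lra.
Qed.

Lemma rare_state_unique g A B : 0 < g -> admissible A -> admissible B ->
  P11 B / depth B ^ 2 = P11 A / depth A ^ 2 ->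
  vel1 B + afun_st g B = vel1 A + afun_st g A ->
  detP B / depth B ^ 2 = detP A / depth A ^ 2 ->
  shear_ratio g B = shear_ratio g A ->
  vel2 B + 2 * shear_ratio g B * afun_st g B = vel2 A + 2 * shear_ratio g A * afun_st g A ->
  B = rare_state g A (depth B / depth A).
Proof.
  intros hg hA hB E1 E2 E3 E4 E5.
  pose proof (shear_ratio_eq g B hg hB) as Es. rewrite E4 in *.
  apply admissible_iff in hA as (Hh & HP & HD).
  apply admissible_iff in hB as (HhB & HPB & HDB).
  set (z := depth B / depth A).
  assert (Eh : depth B = z * depth A) by (unfold z; field; lra).
  assert (Hz : 0 < z) by (unfold z; apply Rdiv_lt_0_compat; auto).
  assert (Ea : afun_st g B = rare_afun g A z).
  { unfold afun_st, rare_afun. rewrite E1, <- Eh. reflexivity. }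
  assert (EP : P11 B = z ^ 2 * P11 A).
  { replace (P11 B) with (P11 B / depth B ^ 2 * depth B ^ 2) by (field; lra).
    rewrite E1, Eh. field. lra. }
  assert (ED : detP B = z ^ 2 * detP A).
  { replace (detP B) with (detP B / depth B ^ 2 * depth B ^ 2) by (field; lra).
    rewrite E3, Eh. field. lra. }
  assert (E12 : P12 B = shear_ratio g A * (g * (z * depth A) + 2 * (z ^ 2 * P11 A)))
    by (rewrite Es, Eh, EP; reflexivity).
  rewrite Ea in *.
  apply state_ext; simpl_rare; auto; try lra.
  rewrite (P22_from_det B) by lra. rewrite ED, EP, E12. reflexivity.
Qed.

(** How far the characteristic speed in the fan lies below [vel1 A + afun_st g A], the speed at
    which the fan would reach vacuum. Its monotonicity in [z] expresses the genuine nonlinearity of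
    the first family. *)
Definition rare_lag g A z : R := rare_afun g A z + sqrt (g * (z * depth A) + 3 * (z ^ 2 * P11 A)).

Lemma rare_state_lambda1 g A z :
  lambda1 g (rare_state g A z) = vel1 A + afun_st g A - rare_lag g A z.
Proof. unfold lambda1, rare_lag. simpl_rare. ring. Qed.

Lemma rare_ratio_pos A : admissible A -> 0 < P11 A / depth A ^ 2.
Proof.
  intros hA. apply admissible_iff in hA as (Hh & HP & HD).
  apply Rdiv_lt_0_compat; auto. apply pow_lt; auto.
Qed.

Lemma rare_lag_lt g A x y : 0 < g -> admissible A -> 0 <= x -> x < y ->
  rare_lag g A x < rare_lag g A y.
Proof.
  intros hg hA Hx L. pose proof (rare_ratio_pos A hA) as Hc.
  apply admissible_iff in hA as (Hh & HP & HD).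
  unfold rare_lag, rare_afun. apply Rplus_lt_compat.
  - apply afun_lt; auto; nra.
  - apply sqrt_lt_1_alt.
    assert (0 <= x ^ 2) by apply pow2_ge_0.
    assert (x ^ 2 < y ^ 2) by (apply pow_lt_incr; auto).
    assert (0 <= x ^ 2 * P11 A) by nra.
    assert (x ^ 2 * P11 A < y ^ 2 * P11 A) by nra.
    assert (0 <= x * depth A) by nra.
    assert (0 <= g * (x * depth A)) by nra.
    assert (x * depth A < y * depth A) by nra.
    assert (g * (x * depth A) < g * (y * depth A)) by nra.
    lra.
Qed.

Lemma rare_afun_continuity_pt g A x : 0 < g -> admissible A -> 0 <= x ->
  continuity_pt (rare_afun g A) x.
Proof.
  intros hg hA Hx. pose proof (rare_ratio_pos A hA) as Hc.
  apply admissible_iff in hA as (Hh & HP & HD). unfold rare_afun.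
  apply (continuity_pt_comp (fun z => z * depth A) (fun y => afun g y (P11 A / depth A ^ 2))).
  - cont_poly; auto.
  - apply afun_continuity_pt; auto. nra.
Qed.

Lemma rare_lag_continuity_pt g A x : 0 < g -> admissible A -> 0 <= x ->
  continuity_pt (rare_lag g A) x.
Proof.
  intros hg hA Hx. unfold rare_lag. apply continuity_pt_plus.
  - apply rare_afun_continuity_pt; auto.
  - apply admissible_iff in hA as (Hh & HP & HD).
    apply (continuity_pt_comp (fun z => g * (z * depth A) + 3 * (z ^ 2 * P11 A)) sqrt).
    + cont_poly; auto.
    + apply continuity_pt_sqrt.
      assert (0 <= x ^ 2) by apply pow2_ge_0.
      assert (0 <= x ^ 2 * P11 A) by nra.
      assert (0 <= x * depth A) by nra. nra.
Qed.

Lemma rare_lag_0 g A : rare_lag g A 0 = 0.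
Proof.
  unfold rare_lag, rare_afun. rewrite Rmult_0_l, afun_0.
  replace (g * 0 + 3 * (0 ^ 2 * P11 A)) with 0 by ring. rewrite sqrt_0. ring.
Qed.

Lemma rare_lag_onto g A y : 0 < g -> admissible A -> 0 < y ->
  exists x, 0 < x /\ rare_lag g A x = y.
Proof.
  intros hg hA Hy.
  apply (increasing_onto_bounds (fun x => 0 < x) (rare_lag g A) y).
  - intros; lra.
  - intros; apply rare_lag_continuity_pt; auto; lra.
  - intros; apply rare_lag_lt; auto; lra.
  - destruct (rare_lag_continuity_pt g A 0 hg hA (Rle_refl 0) y Hy) as (d & Hd & HD).
    simpl in HD. unfold R_dist in HD.
    exists (d / 2). split; [lra|].
    assert (L : Rabs (rare_lag g A (d / 2) - rare_lag g A 0) < y).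
    { apply HD. split; [split; [exact Logic.I|lra]|].
      rewrite Rminus_0_r, Rabs_pos_eq; lra. }
    rewrite rare_lag_0 in L. apply Rabs_def2 in L. lra.
  - pose proof (rare_ratio_pos A hA) as Hc.
    apply admissible_iff in hA as (Hh & HP & HD).
    assert (Hgh : 0 < g * depth A) by nra.
    (* With this ratio [g] times the depth is [y ^ 2], so the square root alone already reaches
       [y]. *)
    exists (y ^ 2 / (g * depth A)). assert (0 < y ^ 2) by (apply pow_lt; auto).
    assert (Hx : 0 < y ^ 2 / (g * depth A)) by (apply Rdiv_lt_0_compat; auto).
    split; auto. unfold rare_lag, rare_afun.
    assert (Hxh : 0 < y ^ 2 / (g * depth A) * depth A) by nra.
    pose proof (afun_lt g (P11 A / depth A ^ 2) 0 _ hg Hc (Rle_refl 0) Hxh) as L.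
    rewrite afun_0 in L.
    cut (y <= sqrt (g * (y ^ 2 / (g * depth A) * depth A)
               + 3 * ((y ^ 2 / (g * depth A)) ^ 2 * P11 A))); [lra|].
    rewrite <- (sqrt_pow2 y) at 1 by lra. apply sqrt_le_1_alt.
    replace (g * (y ^ 2 / (g * depth A) * depth A)) with (y ^ 2) by (field; lra).
    assert (0 <= (y ^ 2 / (g * depth A)) ^ 2 * P11 A)
      by (apply Rmult_le_pos; [apply pow2_ge_0|lra]).
    lra.
Qed.

Lemma rare_state_continuity_pt g A (q : state -> R) x : 0 < g -> admissible A -> 0 < x ->
  In q (depth :: vel1 :: vel2 :: P11 :: P12 :: P22 :: nil) ->
  continuity_pt (fun z => q (rare_state g A z)) x.
Proof.
  intros hg hA Hx Hq.
  assert (Ha : continuity_pt (rare_afun g A) x) by (apply rare_afun_continuity_pt; auto; lra).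
  apply admissible_iff in hA as (Hh & HP & HD).
  assert (Hd : continuity_pt (fun z => rare_afun g A z - afun_st g A) x)
    by (apply continuity_pt_minus; [auto|apply continuity_pt_cst]).
  simpl in Hq. destruct Hq as [<-|[<-|[<-|[<-|[<-|[<-|[]]]]]]]; simpl_rare.
  - cont_poly; auto.
  - apply continuity_pt_minus; [apply continuity_pt_cst|auto].
  - apply continuity_pt_minus; [apply continuity_pt_cst|].
    apply continuity_pt_mult; [apply continuity_pt_cst|auto].
  - cont_poly; auto.
  - cont_poly; auto.
  - cont_poly. apply Rgt_not_eq, Rmult_lt_0_compat; auto.
    nra.
Qed.

(** Inverting the characteristic speed gives the profile [rare_state g A (phi xi)] of the fan. The
    bound on [xi] is the speed of the vacuum edge. *)
Lemma rare_fan_exists g A : 0 < g -> admissible A ->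
  exists phi : R -> R, forall xi, xi < vel1 A + afun_st g A ->
    0 < phi xi /\ lambda1 g (rare_state g A (phi xi)) = xi /\ continuity_pt phi xi.
Proof.
  intros hg hA.
  destruct (functional_choice (fun y x => 0 < y -> 0 < x /\ rare_lag g A x = y)) as [psi Hpsi].
  { intros y. destruct (Rlt_or_le 0 y) as [Hy|Hy].
    - destruct (rare_lag_onto g A y hg hA Hy) as (x & Hx). exists x; auto.
    - exists 0. lra. }
  exists (fun xi => psi (vel1 A + afun_st g A - xi)). intros xi Hxi.
  destruct (Hpsi (vel1 A + afun_st g A - xi)) as [H1 H2]; [lra|].
  split; auto. split; [rewrite rare_state_lambda1; lra|].
  apply (continuity_pt_comp (fun xi => vel1 A + afun_st g A - xi) psi).
  - cont_poly; auto.
  - apply (inverse_continuity_pt (fun x => 0 < x) (fun y => 0 < y) (rare_lag g A)); try lra.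
    + intros; apply rare_lag_lt; auto; lra.
    + intros x Hx. rewrite <- (rare_lag_0 g A). apply rare_lag_lt; auto; lra.
    + intros; lra.
    + auto.
    + intros x Hx. exists x. split; auto. intros t Ht. apply Rabs_def2 in Ht. lra.
Qed.

Lemma rare_state_lambda1_inj g A x y : 0 < g -> admissible A -> 0 < x -> 0 < y ->
  lambda1 g (rare_state g A x) = lambda1 g (rare_state g A y) -> x = y.
Proof.
  intros hg hA Hx Hy. rewrite !rare_state_lambda1. intros E.
  destruct (Rtotal_order x y) as [L|[L|L]]; auto;
    apply (rare_lag_lt g A) in L; auto; lra.
Qed.

Lemma rare_state_lambda1_lt g A x y : 0 < g -> admissible A -> 0 < x -> x < y ->
  lambda1 g (rare_state g A y) < lambda1 g (rare_state g A x).
Proof.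
  intros hg hA Hx L. rewrite !rare_state_lambda1. apply (rare_lag_lt g A) in L; auto; lra.
Qed.

Lemma rare_state_total_pressure g A z : 0 < z <= 1 ->
  R11 (rare_state g A z) + g * depth (rare_state g A z) ^ 2 / 2
  = fcurve g z (depth A) (R11 A).
Proof.
  intros Hz. unfold fcurve. destruct (Rle_dec z 1); [|lra].
  unfold R11. simpl_rare. field.
Qed.

Lemma R11_div_cube A : admissible A -> R11 A / depth A ^ 3 = P11 A / depth A ^ 2.
Proof.
  intros hA. apply admissible_iff in hA as (Hh & HP & HD). unfold R11. field. lra.
Qed.

Lemma rare_state_vel1 g A z : admissible A -> 0 < z <= 1 ->
  vel1 (rare_state g A z) = vel1 A - gcurve g z (depth A) (R11 A).
Proof.
  intros hA Hz. unfold gcurve. destruct (Rle_dec z 1); [|lra].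
  rewrite R11_div_cube by auto. reflexivity.
Qed.

Lemma lambda1_lt_lambda2 g U : 0 < g -> admissible U -> lambda1 g U < lambda2 U.
Proof.
  intros hg hU. apply admissible_iff in hU as (Hh & HP & _). unfold lambda1, lambda2.
  assert (sqrt (P11 U) < sqrt (g * depth U + 3 * P11 U)) by (apply sqrt_lt_1_alt; nra). lra.
Qed.

(** * The complete 1-wave curve: existence and uniqueness of the wave *)

Definition wave1_state g A z : state :=
  if Rle_dec z 1 then rare_state g A z else shock_state g A z.

Lemma wave1_state_admissible g A z : 0 < g -> admissible A -> in02 z ->
  admissible (wave1_state g A z).
Proof.
  intros hg hA [H1 H2]. unfold wave1_state. destruct (Rle_dec z 1).
  - apply rare_state_admissible; auto.
  - apply shock_state_admissible; auto; lra.
Qed.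

Lemma wave1_state_vel1 g A z : 0 < g -> admissible A -> in02 z ->
  vel1 (wave1_state g A z) = gminus g z (depth A) (vel1 A) (R11 A).
Proof.
  intros hg hA [H1 H2]. unfold wave1_state, gminus. destruct (Rle_dec z 1).
  - apply rare_state_vel1; auto.
  - apply shock_state_vel1; auto; lra.
Qed.

Lemma wave1_state_total_pressure g A z : in02 z ->
  R11 (wave1_state g A z) + g * depth (wave1_state g A z) ^ 2 / 2
  = fcurve g z (depth A) (R11 A).
Proof.
  intros [H1 H2]. unfold wave1_state. destruct (Rle_dec z 1).
  - apply rare_state_total_pressure; auto.
  - apply shock_state_total_pressure; lra.
Qed.

(** [b < lambda2] leaves room for the 2-shear wave. The profile is defined on the whole line, so
    that it can be cut where the next wave starts and, reflected, can also serve as a 6-wave. *)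
Lemma wave1_exists g A z : 0 < g -> admissible A -> in02 z ->
  exists W a b, a <= b /\ b < lambda2 (wave1_state g A z) /\
    wave1 g W A (wave1_state g A z) a b /\
    (forall xi, admissible (W xi)) /\
    (forall xi, xi < a -> W xi = A) /\
    (forall xi, b < xi -> W xi = wave1_state g A z).
Proof.
  intros hg hA Hz.
  pose proof (wave1_state_admissible g A z hg hA Hz) as hB.
  destruct Hz as [Hz1 Hz2].
  destruct (Rtotal_order z 1) as [L|[L|L]].
  - assert (EB : wave1_state g A z = rare_state g A z)
      by (unfold wave1_state; destruct (Rle_dec z 1); [auto|lra]).
    rewrite EB in *. clear EB.
    destruct (rare_fan_exists g A hg hA) as [phi Hphi].
    set (a := lambda1 g A). set (b := lambda1 g (rare_state g A z)).
    assert (Lab : a < b).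
    { unfold a, b. rewrite <- (rare_state_1 g A hg hA) at 1.
      apply rare_state_lambda1_lt; auto. }
    assert (Hb : b < vel1 A + afun_st g A).
    { unfold b. rewrite rare_state_lambda1.
      pose proof (rare_lag_lt g A 0 z hg hA (Rle_refl 0) Hz1) as L0.
      rewrite rare_lag_0 in L0. lra. }
    assert (Ea : phi a = 1).
    { destruct (Hphi a) as (P1 & P2 & _); [lra|].
      apply (rare_state_lambda1_inj g A); auto; [lra|]. rewrite rare_state_1 by auto. exact P2. }
    assert (Eb : phi b = z).
    { destruct (Hphi b) as (P1 & P2 & _); [lra|].
      apply (rare_state_lambda1_inj g A); auto. }
    set (W := fun xi => if Rlt_dec xi a then A else if Rlt_dec b xi then rare_state g A z
                        else rare_state g A (phi xi)).
    assert (EW : forall xi, a <= xi <= b -> W xi = rare_state g A (phi xi)).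
    { intros xi Hxi. unfold W. destruct (Rlt_dec xi a); [lra|].
      destruct (Rlt_dec b xi); [lra|reflexivity]. }
    assert (EWa : W a = A) by (rewrite EW, Ea, rare_state_1; auto; lra).
    assert (Hpos : forall xi, a <= xi <= b -> 0 < phi xi)
      by (intros xi Hxi; apply Hphi; lra).
    exists W, a, b. split; [lra|]. split; [apply lambda1_lt_lambda2; auto|].
    split; [|split; [|split]].
    + right; right. split; auto. split; [auto|]. split; [rewrite EW, Eb; auto; lra|].
      split; [|split].
      * intros q Hq. apply (continuous_on_ext (fun xi : R_UniformSpace => a <= xi <= b)
          (fun xi => q (rare_state g A (phi xi)))).
        { intros xi Hxi. rewrite EW by auto. reflexivity. }
        apply continuous_on_forall. intros xi Hxi.
        apply continuity_pt_filterlim.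
        apply (continuity_pt_comp phi (fun x => q (rare_state g A x))).
        { apply Hphi; lra. }
        { apply rare_state_continuity_pt; auto. }
      * intros xi Hxi. rewrite EW by auto. apply Hphi; lra.
      * split; [|split; [|split; [|split]]]; intros xi Hxi; rewrite EWa, EW by auto.
        { apply rare_state_ratio; auto. }
        { rewrite rare_state_afun_st by auto. simpl_rare. ring. }
        { rewrite rare_state_detP by auto. simpl_rare.
          apply admissible_iff in hA as (Hh & _ & _). specialize (Hpos xi Hxi).
          field. lra. }
        { apply rare_state_shear_ratio; auto. }
        { rewrite rare_state_shear_ratio, rare_state_afun_st by auto. simpl_rare. ring. }
    + intros xi. unfold W. destruct (Rlt_dec xi a); auto.
      destruct (Rlt_dec b xi); auto. apply rare_state_admissible; auto. apply Hpos; lra.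
    + intros xi Hxi. unfold W. destruct (Rlt_dec xi a); auto; lra.
    + intros xi Hxi. unfold W. destruct (Rlt_dec xi a); [lra|].
      destruct (Rlt_dec b xi); [auto|lra].
  - assert (EB : wave1_state g A z = A).
    { subst z. unfold wave1_state. destruct (Rle_dec 1 1); [|lra]. apply rare_state_1; auto. }
    rewrite EB. exists (fun _ => A), (lambda1 g A), (lambda1 g A).
    split; [lra|]. split; [apply lambda1_lt_lambda2; auto|].
    split; [left; auto|auto].
  - assert (EB : wave1_state g A z = shock_state g A z)
      by (unfold wave1_state; destruct (Rle_dec z 1); [lra|auto]).
    rewrite EB in *.
    set (S := vel1 A - shock_flow g A z).
    exists (fun xi => if Rlt_dec xi S then A else shock_state g A z), S, S.
    split; [lra|]. split; [apply shock_state_lambda2; auto|].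
    split; [right; left; split; auto; apply shock_state_shock1; auto|].
    split; [|split]; intros xi.
    + destruct (Rlt_dec xi S); auto.
    + intros Hxi. destruct (Rlt_dec xi S); auto; lra.
    + intros Hxi. destruct (Rlt_dec xi S); auto; lra.
Qed.

Lemma rarefaction1_inv g W A B a b xi :
  0 < g -> admissible A -> (forall xi, admissible (W xi)) ->
  rarefaction1 g W A B a b -> a <= xi <= b ->
  W xi = rare_state g A (depth (W xi) / depth A) /\
  lambda1 g (rare_state g A (depth (W xi) / depth A)) = xi.
Proof.
  intros hg hA hW (Ha & Hb & _ & Hl & C1 & C2 & C3 & C4 & C5) Hxi.
  assert (E : W xi = rare_state g A (depth (W xi) / depth A)).
  { specialize (C1 xi Hxi). specialize (C2 xi Hxi). specialize (C3 xi Hxi).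
    specialize (C4 xi Hxi). specialize (C5 xi Hxi). rewrite Ha in *.
    apply rare_state_unique; auto. }
  split; auto. rewrite <- E. auto.
Qed.

Lemma depth_ratio_pos A B : admissible A -> admissible B -> 0 < depth B / depth A.
Proof. intros [H _] [H' _]. apply Rdiv_lt_0_compat; auto. Qed.

Lemma rarefaction1_depth g W A B a b :
  0 < g -> admissible A -> (forall xi, admissible (W xi)) -> a < b ->
  rarefaction1 g W A B a b -> B = rare_state g A (depth B / depth A) /\
    a = lambda1 g A /\ b = lambda1 g B /\ 0 < depth B / depth A < 1.
Proof.
  intros hg hA hW Lab HR.
  pose proof (rarefaction1_inv g W A B a b b hg hA hW HR) as [E1 E2]; [lra|].
  pose proof (hW b) as hB.
  destruct HR as (Ha & Hb & _ & Hl & _).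
  pose proof (Hl a) as Hla. pose proof (Hl b) as Hlb. rewrite Ha in Hla.
  rewrite Hb in *.
  pose proof (depth_ratio_pos A B hA hB) as Hr.
  split; auto. split; [symmetry; apply Hla; lra|]. split; [symmetry; apply Hlb; lra|].
  split; auto.
  (* [lambda1] decreases with the depth ratio while [xi] increases through the fan, so a fan of
     positive width must lower the depth. *)
  destruct (Rlt_or_le (depth B / depth A) 1) as [|C]; auto. exfalso.
  assert (lambda1 g (rare_state g A (depth B / depth A)) <= lambda1 g (rare_state g A 1)).
  { destruct C as [C|C]; [left; apply rare_state_lambda1_lt; auto; lra|rewrite C; lra]. }
  rewrite rare_state_1, E2, Hla in H by (auto; lra). lra.
Qed.

Lemma wave1_inv g W A B a b : 0 < g -> admissible A -> admissible B ->
  (forall xi, admissible (W xi)) -> wave1 g W A B a b ->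
  in02 (depth B / depth A) /\ B = wave1_state g A (depth B / depth A).
Proof.
  intros hg hA hB hW [[_ E]|[[_ Hs]|[Hab HR]]].
  - subst B. assert (depth A / depth A = 1) by (destruct hA; field; lra). rewrite H.
    split; [unfold in02; lra|]. unfold wave1_state. destruct (Rle_dec 1 1); [|lra].
    symmetry; apply rare_state_1; auto.
  - destruct (shock1_inv g A B a hg hA hB Hs) as (z & Hz & E & _).
    assert (Ez : depth B / depth A = z).
    { rewrite E. simpl_state. destruct hA. field. lra. }
    rewrite Ez. split; [unfold in02; lra|].
    unfold wave1_state. destruct (Rle_dec z 1); [lra|auto].
  - destruct (rarefaction1_depth g W A B a b) as (E & _ & _ & Hr); auto.
    split; [unfold in02; lra|]. unfold wave1_state.
    destruct (Rle_dec (depth B / depth A) 1); [auto|lra].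
Qed.

(** [s] is the position of the next wave, beyond which [W] no longer has to equal [B]. *)
Definition wave1_region g W A B a b s : Prop :=
  wave1 g W A B a b /\ (forall xi, admissible (W xi)) /\
  (forall xi, xi < a -> W xi = A) /\ (forall xi, b < xi < s -> W xi = B).

(** The end states decide everything: a depth ratio above, at or below 1 means a shock, no wave or a
    fan, and the states give the shock speed or the edges of the fan. The edges are excluded because
    the value at a shock is free and a trivial wave may sit at any position. *)
Lemma wave1_region_unique g A B s W a b W' a' b' : 0 < g -> admissible A -> admissible B ->
  wave1_region g W A B a b s -> wave1_region g W' A B a' b' s ->
  forall xi, xi < s -> xi <> a -> xi <> a' -> xi <> b -> xi <> b' -> W xi = W' xi.
Proof.
  intros hg hA hB (H & hW & HA & HB) (H' & hW' & HA' & HB') xi Hs N1 N2 N3 N4.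
  destruct (Req_dec (depth B) (depth A)) as [Ed|Nd].
  - (* only the trivial wave preserves the depth *)
    assert (Triv : forall W a b, (forall xi, admissible (W xi)) -> wave1 g W A B a b ->
              a = b /\ A = B).
    { clear - hg hA hB Ed. intros W a b hW [?|[[_ Hs]|[Hab HR]]]; auto; exfalso.
      - destruct (shock1_inv g A B a hg hA hB Hs) as (z & Hz & E & _).
        rewrite E in Ed. cbn [depth shock_state] in Ed. destruct hA. nra.
      - destruct (rarefaction1_depth g W A B a b) as (E & _ & _ & Hr); auto.
        rewrite Ed in Hr. destruct hA. replace (depth A / depth A) with 1 in Hr by (field; lra).
        lra. }
    destruct (Triv W a b hW H) as [-> EAB]. destruct (Triv W' a' b' hW' H') as [-> _].
    subst B. transitivity A; [|symmetry].
    + destruct (Rtotal_order xi b) as [|[|]]; auto; lra.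
    + destruct (Rtotal_order xi b') as [|[|]]; auto; lra.
  - assert (Hr : depth B / depth A <> 1).
    { intros E. apply Nd. replace (depth B) with (depth B / depth A * depth A)
        by (destruct hA; field; lra). rewrite E. ring. }
    assert (Shock : forall S, shock1 g A B S ->
              1 < depth B / depth A /\ S = vel1 A - shock_flow g A (depth B / depth A)).
    { intros S HS. destruct (shock1_inv g A B S hg hA hB HS) as (z & Hz & E & ES).
      assert (Ez : depth B / depth A = z).
      { rewrite E. simpl_state. destruct hA. field. lra. }
      rewrite Ez. split; [lra|auto]. }
    destruct H as [[_ E]|[[Eab HS]|[Hab HR]]]; [subst; lra| |].
    + destruct (Shock a HS) as [S1 S2].
      destruct H' as [[_ E]|[[Eab' HS']|[Hab' HR']]]; [subst; lra| |].
      * destruct (Shock a' HS') as [_ S2']. assert (a = a') by lra. subst a b a' b'.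
        destruct (Rtotal_order xi (vel1 A - shock_flow g A (depth B / depth A))) as [L|[L|L]];
          [rewrite (HA xi), (HA' xi)|lra|rewrite (HB xi), (HB' xi)]; auto.
      * destruct (rarefaction1_depth g W' A B a' b') as (_ & _ & _ & Hr'); auto. lra.
    + destruct (rarefaction1_depth g W A B a b) as (E & Ea & Eb & Hr1); auto.
      destruct H' as [[_ E']|[[Eab' HS']|[Hab' HR']]]; [subst; lra| |].
      * destruct (Shock a' HS') as [S1 _]. lra.
      * destruct (rarefaction1_depth g W' A B a' b') as (_ & Ea' & Eb' & _); auto.
        rewrite <- Ea in Ea'. rewrite <- Eb in Eb'. rewrite Ea', Eb' in *.
        destruct (Rlt_or_le xi a); [rewrite (HA xi), (HA' xi); auto|].
        destruct (Rlt_or_le b xi); [rewrite (HB xi), (HB' xi); auto|].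
        destruct (rarefaction1_inv g W A B a b xi hg hA hW HR) as [F1 F2]; [lra|].
        destruct (rarefaction1_inv g W' A B a b xi hg hA hW' HR') as [F1' F2']; [lra|].
        rewrite F1, F1'. f_equal.
        apply (rare_state_lambda1_inj g A); auto; try (apply depth_ratio_pos; auto).
        congruence.
Qed.

(** * Reflection and the intermediate states *)

(** The symmetry [x -> - x] of the system, which exchanges 1-waves and 6-waves. *)
Definition refl (U : state) : state :=
  mkState (depth U) (- vel1 U) (vel2 U) (P11 U) (- P12 U) (P22 U).

Lemma refl_involutive U : refl (refl U) = U.
Proof. apply state_ext; simpl; ring. Qed.

Lemma refl_detP U : detP (refl U) = detP U.
Proof. unfold detP; simpl; ring. Qed.

Lemma refl_admissible U : admissible U -> admissible (refl U).
Proof. rewrite !admissible_iff, refl_detP. simpl. auto. Qed.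

Lemma refl_lambda1 g U : lambda1 g (refl U) = - lambda6 g U.
Proof. unfold lambda1, lambda6; simpl; ring. Qed.

Lemma refl_lambda6 g U : lambda6 g (refl U) = - lambda1 g U.
Proof. unfold lambda1, lambda6; simpl; ring. Qed.

Lemma refl_lambda2 U : lambda2 (refl U) = - lambda5 U.
Proof. unfold lambda2, lambda5; simpl; ring. Qed.

Lemma refl_shear_ratio g U : shear_ratio g (refl U) = - shear_ratio g U.
Proof. unfold shear_ratio, Rdiv; simpl; ring. Qed.

Lemma refl_rankine_hugoniot g A B S :
  rankine_hugoniot g A B S -> rankine_hugoniot g (refl B) (refl A) (- S).
Proof.
  unfold rankine_hugoniot, jump, mean, mom1, mom2, E11, E12, E22, R11, R12, R22. simpl.
  intros (H1 & H2 & H3 & H4 & H5 & H6). repeat split; lra.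
Qed.

Lemma continuous_on_reflect (f : R -> R) (a b : R) :
  continuous_on (fun xi : R_UniformSpace => a <= xi <= b) f ->
  continuous_on (fun xi : R_UniformSpace => - b <= xi <= - a) (fun xi => f (- xi)).
Proof.
  intros H x Hx.
  apply (filterlim_comp _ _ _ (fun xi => - xi) f _ (within (fun xi => a <= xi <= b) (locally (- x)))).
  - intros Q HQ.
    assert (C : continuous (fun xi : R => - xi) x)
      by (apply (continuous_opp (fun y : R => y) x), continuous_id).
    specialize (C _ HQ). unfold filtermap, within in *.
    revert C. apply filter_imp. intros y C Hy. apply C. lra.
  - apply H. lra.
Qed.

Lemma profile_continuous_on_refl W a b :
  profile_continuous_on W a b ->
  profile_continuous_on (fun xi => refl (W (- xi))) (- b) (- a).
Proof.
  intros H q Hq.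
  assert (T : exists q', In q' (depth :: vel1 :: vel2 :: P11 :: P12 :: P22 :: nil) /\
            ((forall U, q (refl U) = q' U) \/ (forall U, q (refl U) = - q' U))).
  { exists q. split; auto. simpl in Hq.
    destruct Hq as [<-|[<-|[<-|[<-|[<-|[<-|[]]]]]]]; auto. }
  destruct T as (q' & Hq' & Eq). pose proof (continuous_on_reflect _ a b (H q' Hq')) as C.
  destruct Eq as [Eq|Eq].
  - apply (continuous_on_ext (fun xi : R_UniformSpace => - b <= xi <= - a)
             (fun xi => q' (W (- xi)))); [intros xi _; symmetry; apply Eq|exact C].
  - apply (continuous_on_ext (fun xi : R_UniformSpace => - b <= xi <= - a)
             (fun xi => - q' (W (- xi)))).
    + intros xi _. symmetry; apply Eq.
    + intros x Hx. apply (filterlim_comp _ _ _ _ (fun y => - y) _ _ _ (C x Hx)).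
      apply (continuous_opp (fun y : R => y)), continuous_id.
Qed.

(** [constant_along] compares with the left endpoint, and reflection turns the old right endpoint
    into the reference; both are therefore compared with [W a]. The two cases are quantities that
    are even or odd under reflection. *)
Lemma constant_along_refl (q q' : state -> R) W a b : a < b ->
  (forall U, q' (refl U) = q U) \/ (forall U, q' (refl U) = - q U) ->
  constant_along q W a b ->
  constant_along q' (fun xi => refl (W (- xi))) (- b) (- a).
Proof.
  intros Lab Eq H xi Hxi. pose proof (H (- xi)) as H1. pose proof (H (- - b)) as H2.
  destruct Eq as [Eq|Eq]; rewrite !Eq; [|f_equal];
    rewrite H1 by lra; symmetry; apply H2; lra.
Qed.

Lemma rarefaction6_refl g W A B a b : a < b -> rarefaction6 g W A B a b ->
  rarefaction1 g (fun xi => refl (W (- xi))) (refl B) (refl A) (- b) (- a).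
Proof.
  intros Lab (Ha & Hb & Hc & Hl & C1 & C2 & C3 & C4 & C5).
  split; [rewrite Ropp_involutive, Hb; auto|].
  split; [rewrite Ropp_involutive, Ha; auto|].
  split; [apply profile_continuous_on_refl; auto|].
  split; [intros xi Hxi; rewrite refl_lambda1, Hl; lra|].
  split; [|split; [|split; [|split]]].
  - eapply constant_along_refl; [auto| |exact C1]. left; reflexivity.
  - eapply constant_along_refl; [auto| |exact C2]. right; intros U.
    unfold afun_st; simpl; ring.
  - eapply constant_along_refl; [auto| |exact C3]. left; intros U.
    rewrite refl_detP. reflexivity.
  - eapply constant_along_refl; [auto| |exact C4]. right; apply refl_shear_ratio.
  - eapply constant_along_refl; [auto| |exact C5]. left; intros U.
    rewrite refl_shear_ratio. unfold afun_st; simpl; ring.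
Qed.

Lemma rarefaction1_refl g W A B a b : a < b -> rarefaction1 g W A B a b ->
  rarefaction6 g (fun xi => refl (W (- xi))) (refl B) (refl A) (- b) (- a).
Proof.
  intros Lab (Ha & Hb & Hc & Hl & C1 & C2 & C3 & C4 & C5).
  split; [rewrite Ropp_involutive, Hb; auto|].
  split; [rewrite Ropp_involutive, Ha; auto|].
  split; [apply profile_continuous_on_refl; auto|].
  split; [intros xi Hxi; rewrite refl_lambda6, Hl; lra|].
  split; [|split; [|split; [|split]]].
  - eapply constant_along_refl; [auto| |exact C1]. left; reflexivity.
  - eapply constant_along_refl; [auto| |exact C2]. right; intros U.
    unfold afun_st; simpl; ring.
  - eapply constant_along_refl; [auto| |exact C3]. left; intros U.
    rewrite refl_detP. reflexivity.
  - eapply constant_along_refl; [auto| |exact C4]. right; apply refl_shear_ratio.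
  - eapply constant_along_refl; [auto| |exact C5]. left; intros U.
    rewrite refl_shear_ratio. unfold afun_st; simpl; ring.
Qed.

Lemma wave6_refl g W A B a b : wave6 g W A B a b ->
  wave1 g (fun xi => refl (W (- xi))) (refl B) (refl A) (- b) (- a).
Proof.
  intros [[E1 E2]|[[E (RH & L1 & L2)]|[L HR]]].
  - left; subst; auto.
  - right; left. subst b. split; auto. split; [apply refl_rankine_hugoniot; auto|].
    rewrite !refl_lambda1. lra.
  - right; right. split; [lra|]. apply rarefaction6_refl; auto.
Qed.

Lemma wave1_refl g W A B a b : wave1 g W A B a b ->
  wave6 g (fun xi => refl (W (- xi))) (refl B) (refl A) (- b) (- a).
Proof.
  intros [[E1 E2]|[[E (RH & L1 & L2)]|[L HR]]].
  - left; subst; auto.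
  - right; left. subst b. split; auto. split; [apply refl_rankine_hugoniot; auto|].
    rewrite !refl_lambda6. lra.
  - right; right. split; [lra|]. apply rarefaction1_refl; auto.
Qed.

Lemma profile_continuous_on_eq W W' a b : (forall xi, a <= xi <= b -> W' xi = W xi) ->
  profile_continuous_on W a b -> profile_continuous_on W' a b.
Proof.
  intros E H q Hq.
  apply (continuous_on_ext (fun xi : R_UniformSpace => a <= xi <= b) (fun xi => q (W xi)));
    [intros xi Hxi; rewrite E; auto|exact (H q Hq)].
Qed.

Lemma constant_along_eq q W W' a b : a < b -> (forall xi, a <= xi <= b -> W' xi = W xi) ->
  constant_along q W a b -> constant_along q W' a b.
Proof. intros L E H xi Hxi. rewrite !E by lra. auto. Qed.

(** For transferring a wave to a glued profile: trivial waves and shocks do not look at [W], and a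
    fan looks only at its closed interval. *)
Lemma wave1_eq g W W' A B a b : (forall xi, a <= xi <= b -> W' xi = W xi) ->
  wave1 g W A B a b -> wave1 g W' A B a b.
Proof.
  intros E [H|[H|[L (Ha & Hb & Hc & Hl & C1 & C2 & C3 & C4 & C5)]]]; [left; auto|right; left; auto|].
  right; right. split; auto. split; [rewrite E; auto; lra|]. split; [rewrite E; auto; lra|].
  split; [apply (profile_continuous_on_eq W); auto|].
  split; [intros xi Hxi; rewrite E; auto|].
  repeat split; apply (constant_along_eq _ W); auto.
Qed.

Lemma wave6_eq g W W' A B a b : (forall xi, a <= xi <= b -> W' xi = W xi) ->
  wave6 g W A B a b -> wave6 g W' A B a b.
Proof.
  intros E [H|[H|[L (Ha & Hb & Hc & Hl & C1 & C2 & C3 & C4 & C5)]]]; [left; auto|right; left; auto|].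
  right; right. split; auto. split; [rewrite E; auto; lra|]. split; [rewrite E; auto; lra|].
  split; [apply (profile_continuous_on_eq W); auto|].
  split; [intros xi Hxi; rewrite E; auto|].
  repeat split; apply (constant_along_eq _ W); auto.
Qed.

(** * The states between the shear waves *)

Lemma middle_exists g AL AR : admissible AL -> admissible AR ->
  vel1 AL = vel1 AR ->
  g * depth AL ^ 2 / 2 + R11 AL = g * depth AR ^ 2 / 2 + R11 AR ->
  exists BL BR, admissible BL /\ admissible BR /\ shear2 AL BL (lambda2 AL) /\
    contact g BL BR (vel1 AL) /\ shear5 BR AR (lambda5 AR).
Proof.
  intros hL hR Eu Ep.
  apply admissible_iff in hL as (HhL & HPL & HDL).
  apply admissible_iff in hR as (HhR & HPR & HDR).
  assert (HsL : 0 < sqrt (P11 AL)) by (apply sqrt_lt_R0; auto).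
  assert (HsR : 0 < sqrt (P11 AR)) by (apply sqrt_lt_R0; auto).
  set (sL := sqrt (P11 AL)) in *. set (sR := sqrt (P11 AR)) in *.
  set (KL := vel2 AL * sL + P12 AL). set (KR := vel2 AR * sR - P12 AR).
  assert (Hden : 0 < depth AL * sL + depth AR * sR) by nra.
  (* The shear waves preserve [KL] and [KR]. A common transverse velocity [v] turns continuity of
     [R12] at the contact into [depth AL * (KL - v * sL) = depth AR * (v * sR - KR)], which is
     solved for [v]. *)
  set (v := (depth AL * KL + depth AR * KR) / (depth AL * sL + depth AR * sR)).
  set (pL := KL - v * sL). set (pR := v * sR - KR).
  assert (Epp : depth AL * pL = depth AR * pR).
  { assert (v * (depth AL * sL + depth AR * sR) = depth AL * KL + depth AR * KR)
      by (unfold v; field; lra).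
    unfold pL, pR. lra. }
  (* [P22] is chosen to keep [detP]; as depth and [P11] are unchanged, admissibility is
     inherited. *)
  exists (mkState (depth AL) (vel1 AL) v (P11 AL) pL ((detP AL + pL ^ 2) / P11 AL)).
  exists (mkState (depth AR) (vel1 AR) v (P11 AR) pR ((detP AR + pR ^ 2) / P11 AR)).
  assert (DL : detP (mkState (depth AL) (vel1 AL) v (P11 AL) pL ((detP AL + pL ^ 2) / P11 AL))
               = detP AL)
    by (unfold detP at 1; cbn [P11 P12 P22]; field; lra).
  assert (DR : detP (mkState (depth AR) (vel1 AR) v (P11 AR) pR ((detP AR + pR ^ 2) / P11 AR))
               = detP AR)
    by (unfold detP at 1; cbn [P11 P12 P22]; field; lra).
  split; [apply admissible_iff; rewrite DL; auto|].
  split; [apply admissible_iff; rewrite DR; auto|].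
  split; [|split].
  - unfold shear2. rewrite DL. simpl. fold sL. repeat split. unfold pL, KL. ring.
  - unfold contact, R11, R12 in *. simpl. repeat split; auto.
  - unfold shear5. rewrite DR. unfold lambda5. simpl. fold sR. repeat split.
    unfold pR, KR. ring.
Qed.

Lemma middle_unique g AL AR BL BR CL CR s2 s3 s5 s2' s3' s5' :
  admissible AL -> admissible AR ->
  shear2 AL BL s2 -> contact g BL BR s3 -> shear5 BR AR s5 ->
  shear2 AL CL s2' -> contact g CL CR s3' -> shear5 CR AR s5' ->
  BL = CL /\ BR = CR.
Proof.
  intros hL hR (_ & A1 & A2 & A3 & A4 & A5) (_ & B1 & B2 & B3 & B4) (_ & C1 & C2 & C3 & C4 & C5)
    (_ & A1' & A2' & A3' & A4' & A5') (_ & B1' & B2' & B3' & B4')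
    (_ & C1' & C2' & C3' & C4' & C5').
  apply admissible_iff in hL as (HhL & HPL & HDL).
  apply admissible_iff in hR as (HhR & HPR & HDR).
  assert (HsL : 0 < sqrt (P11 AL)) by (apply sqrt_lt_R0; auto).
  assert (HsR : 0 < sqrt (P11 AR)) by (apply sqrt_lt_R0; auto).
  unfold R12 in *.
  rewrite C3 in C4. rewrite C3' in C4'. rewrite <- A3 in A4. rewrite <- A3' in A4'.
  rewrite <- A1, C1 in B3. rewrite <- A1', C1' in B3'.
  set (sL := sqrt (P11 AL)) in *. set (sR := sqrt (P11 AR)) in *.
  rewrite <- B2 in C4. rewrite <- B2' in C4'.
  assert (Ev : vel2 BL = vel2 CL).
  (* In the sum of the two shear invariants weighted by the depths, the [P12] terms cancel by the
     contact condition, leaving [vel2] times this positive coefficient. *)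
  { apply Rmult_eq_reg_r with (depth AL * sL + depth AR * sR); [|nra].
    assert (depth AL * (vel2 BL * sL + P12 BL) = depth AL * (vel2 CL * sL + P12 CL))
      by (rewrite <- A4, <- A4'; reflexivity).
    assert (depth AR * (vel2 BL * sR - P12 BR) = depth AR * (vel2 CL * sR - P12 CR))
      by (rewrite C4, C4'; reflexivity).
    lra. }
  assert (EL : P12 BL = P12 CL) by (rewrite Ev in A4; lra).
  assert (ER : P12 BR = P12 CR) by (rewrite Ev in C4; lra).
  split; apply state_ext; try congruence.
  - rewrite !P22_from_det by lra. congruence.
  - rewrite !P22_from_det by lra. congruence.
Qed.

Lemma wave6_inv g W A B a b : 0 < g -> admissible A -> admissible B ->
  (forall xi, admissible (W xi)) -> wave6 g W A B a b ->
  in02 (depth A / depth B) /\ A = refl (wave1_state g (refl B) (depth A / depth B)).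
Proof.
  intros hg hA hB hW H. apply wave6_refl in H. apply wave1_inv in H; auto using refl_admissible.
  destruct H as [H1 H2]. cbn [depth refl] in H1, H2. split; auto.
  rewrite <- H2, refl_involutive. reflexivity.
Qed.

Lemma star_state_right g B z : 0 < g -> admissible B -> in02 z ->
  vel1 (refl (wave1_state g (refl B) z)) = gplus g z (depth B) (vel1 B) (R11 B) /\
  R11 (refl (wave1_state g (refl B) z)) + g * depth (refl (wave1_state g (refl B) z)) ^ 2 / 2
  = fcurve g z (depth B) (R11 B).
Proof.
  intros hg hB Hz. split.
  - cbn [vel1 refl]. rewrite wave1_state_vel1 by auto using refl_admissible.
    unfold gminus, gplus, R11. cbn [vel1 depth P11 refl]. ring.
  - apply (wave1_state_total_pressure g (refl B) z Hz).
Qed.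

(** * Solving [F = G = 0] and assembling the Riemann solution *)

Definition star_pair g UL UR (z : R * R) : Prop :=
  (0 < fst z < 2 /\ 0 < snd z < 2) /\
  Fstar g UL UR (fst z) (snd z) = 0 /\ Gstar g UL UR (fst z) (snd z) = 0.

Lemma star_pair_exists_unique g UL UR : 0 < g -> admissible UL -> admissible UR ->
  vel1 UR - vel1 UL < afun g (depth UL) (R11 UL / depth UL ^ 3)
                      + afun g (depth UR) (R11 UR / depth UR ^ 3) ->
  exists! z, star_pair g UL UR z.
Proof.
  intros hg hL hR Hd.
  apply admissible_iff in hL as (HhL & HPL & _). apply admissible_iff in hR as (HhR & HPR & _).
  assert (HrL : 0 < R11 UL) by (apply Rmult_lt_0_compat; auto).
  assert (HrR : 0 < R11 UR) by (apply Rmult_lt_0_compat; auto).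
  (* [G = 0] says that the two [gcurve] values add up to [vel1 UL - vel1 UR]. The no-vacuum
     hypothesis says exactly that this number exceeds the sum of their infima. *)
  destruct (curve_intersection
    (fun z => fcurve g z (depth UL) (R11 UL)) (fun z => fcurve g z (depth UR) (R11 UR))
    (fun z => gcurve g z (depth UL) (R11 UL)) (fun z => gcurve g z (depth UR) (R11 UR))
    (vel1 UL - vel1 UR) (- afun g (depth UL) (R11 UL / depth UL ^ 3))
    (- afun g (depth UR) (R11 UR / depth UR ^ 3)))
    as (z1 & z2 & H1 & H2 & Hf & Hg);
    auto using fcurve_increasing, gcurve_increasing, fcurve_continuous, gcurve_continuous,
      fcurve_onto, gcurve_onto; [lra|].
  cbv beta in Hf, Hg.
  exists (z1, z2). unfold star_pair, Fstar, Gstar, gminus, gplus.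
  split; [cbn [fst snd]; split; [split; auto|split; lra]|].
  intros [y1 y2] ((K1 & K2) & Kf & Kg). cbn [fst snd] in *.
  destruct (curve_intersection_unique
    (fun z => fcurve g z (depth UL) (R11 UL)) (fun z => fcurve g z (depth UR) (R11 UR))
    (fun z => gcurve g z (depth UL) (R11 UL)) (fun z => gcurve g z (depth UR) (R11 UR))
    z1 z2 y1 y2) as [-> ->];
    auto using fcurve_increasing, gcurve_increasing; cbv beta; lra.
Qed.

(** Normal velocity and total pressure are continuous across the shear waves and the contact, so
    they agree at the inner ends of the 1-wave and the 6-wave. *)
Lemma star_states_pair g UL UR AL AR BL BR s2 s3 s5 z1 z2 :
  0 < g -> admissible UL -> admissible UR -> in02 z1 -> in02 z2 ->
  AL = wave1_state g UL z1 -> AR = refl (wave1_state g (refl UR) z2) ->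
  shear2 AL BL s2 -> contact g BL BR s3 -> shear5 BR AR s5 ->
  star_pair g UL UR (z1, z2).
Proof.
  intros hg hL hR H1 H2 EL ER (_ & A1 & A2 & A3 & _) (_ & B1 & _ & _ & B4) (_ & C1 & C2 & C3 & _).
  split; [split; auto|]. unfold Fstar, Gstar. cbn [fst snd].
  destruct (star_state_right g UR z2 hg hR H2) as [Ev Ep]. rewrite <- ER in Ev, Ep.
  rewrite <- Ev, <- Ep.
  rewrite <- (wave1_state_vel1 g UL z1 hg hL H1), <- (wave1_state_total_pressure g UL z1 H1).
  rewrite <- EL. unfold R11 in *. rewrite A1, A2, A3, <- C1, <- C2, <- C3. split; lra.
Qed.

Lemma riemann_solution_unique g UL UR W W' : 0 < g -> admissible UL -> admissible UR ->
  (exists! z, star_pair g UL UR z) ->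
  riemann_solution g UL UR W -> riemann_solution g UL UR W' -> same_profile W W'.
Proof.
  intros hg hL hR (z & _ & Uz)
    (hW & AL & BL & BR & AR & a1 & b1 & s2 & s3 & s5 & a6 & b6 & (hAL & hBL & hBR & hAR) & _ &
      V1 & V2 & V3 & V5 & V6 & Q1 & Q2 & Q3 & Q4 & Q5 & Q6)
    (hW' & AL' & BL' & BR' & AR' & a1' & b1' & s2' & s3' & s5' & a6' & b6' &
      (hAL' & hBL' & hBR' & hAR') & _ &
      V1' & V2' & V3' & V5' & V6' & Q1' & Q2' & Q3' & Q4' & Q5' & Q6').
  destruct (wave1_inv g W UL AL a1 b1) as [I1 E1]; auto.
  destruct (wave1_inv g W' UL AL' a1' b1') as [I1' E1']; auto.
  destruct (wave6_inv g W AR UR a6 b6) as [I6 E6]; auto.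
  destruct (wave6_inv g W' AR' UR a6' b6') as [I6' E6']; auto.
  assert (Ez : (depth AL / depth UL, depth AR / depth UR)
               = (depth AL' / depth UL, depth AR' / depth UR)).
  { transitivity z; [symmetry|]; apply Uz.
    - eapply star_states_pair; eauto.
    - eapply star_states_pair; eauto. }
  injection Ez as Ez1 Ez2.
  assert (EL : AL' = AL) by (rewrite E1', <- Ez1; auto).
  assert (ER : AR' = AR) by (rewrite E6', <- Ez2; auto).
  subst AL' AR'.
  destruct (middle_unique g AL AR BL BR BL' BR' s2 s3 s5 s2' s3' s5') as [EBL EBR]; auto.
  subst BL' BR'.
  (* Each linearly degenerate wave moves at a speed read off from the state on its left. *)
  assert (s2' = s2) by (destruct V2, V2'; congruence).
  assert (s3' = s3) by (destruct V3, V3'; congruence).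
  assert (s5' = s5) by (destruct V5, V5'; congruence).
  subst s2' s3' s5'.
  exists (a1 :: b1 :: a1' :: b1' :: s2 :: s3 :: s5 :: a6 :: b6 :: a6' :: b6' :: nil).
  intros xi Hxi. simpl in Hxi.
  destruct (Rtotal_order xi s2) as [L2|[L2|L2]]; [|subst xi; tauto|].
  { apply (wave1_region_unique g UL AL s2 W a1 b1 W' a1' b1');
      first [solve [auto] | solve [intros C; subst xi; tauto] | split; [auto|split; auto]]. }
  destruct (Rtotal_order xi s3) as [L3|[L3|L3]]; [rewrite Q3, Q3'; auto|subst xi; tauto|].
  destruct (Rtotal_order xi s5) as [L5|[L5|L5]]; [rewrite Q4, Q4'; auto|subst xi; tauto|].
  (* To the right of [s5] the reflected profiles are compared, in which the 6-wave has become a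
     1-wave. *)
  rewrite <- (refl_involutive (W xi)), <- (refl_involutive (W' xi)). f_equal.
  rewrite <- (Ropp_involutive xi).
  assert (N : - xi <> - b6 /\ - xi <> - b6' /\ - xi <> - a6 /\ - xi <> - a6')
    by (repeat split; intros C; apply Ropp_eq_reg in C; subst xi; tauto).
  apply (wave1_region_unique g (refl UR) (refl AR) (- s5)
           (fun y => refl (W (- y))) (- b6) (- a6) (fun y => refl (W' (- y))) (- b6') (- a6'));
    try apply N; auto using refl_admissible; try lra.
  - split; [apply wave6_refl; auto|]. split; [intros; apply refl_admissible; auto|].
    split; intros y Hy; f_equal; [apply Q6|apply Q5]; lra.
  - split; [apply wave6_refl; auto|]. split; [intros; apply refl_admissible; auto|].
    split; intros y Hy; f_equal; [apply Q6'|apply Q5']; lra.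
Qed.

Lemma riemann_solution_exists g UL UR z : 0 < g -> admissible UL -> admissible UR ->
  star_pair g UL UR z -> exists W, riemann_solution g UL UR W.
Proof.
  destruct z as [z1 z2]. intros hg hL hR ((H1 & H2) & HF & HG). cbn [fst snd] in *.
  destruct (wave1_exists g UL z1 hg hL H1) as (WL & a1 & b1 & L1 & M1 & V1 & hWL & QL1 & QL2).
  destruct (wave1_exists g (refl UR) z2 hg (refl_admissible _ hR) H2)
    as (WR & a & b & L6 & M6 & V6 & hWR & QR1 & QR2).
  pose proof (wave1_state_admissible g UL z1 hg hL H1) as hAL.
  pose proof (wave1_state_admissible g (refl UR) z2 hg (refl_admissible _ hR) H2) as hAR.
  pose proof (wave1_state_vel1 g UL z1 hg hL H1) as EuL.
  pose proof (wave1_state_total_pressure g UL z1 H1) as EpL.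
  destruct (star_state_right g UR z2 hg hR H2) as [EuR EpR].
  apply wave1_refl in V6. rewrite refl_involutive in V6.
  apply refl_admissible in hAR.
  rewrite <- (refl_involutive (wave1_state g (refl UR) z2)), refl_lambda2 in M6.
  set (AL := wave1_state g UL z1) in *. set (AR := refl (wave1_state g (refl UR) z2)) in *.
  unfold Fstar in HF. unfold Gstar in HG.
  destruct (middle_exists g AL AR) as (BL & BR & hBL & hBR & S2 & S3 & S5); auto; try lra.
  set (s2 := lambda2 AL) in *. set (s3 := vel1 AL) in *. set (s5 := lambda5 AR) in *.
  assert (O23 : s2 < s3).
  { unfold s2, s3, lambda2. apply admissible_iff in hAL as (_ & HP & _).
    pose proof (sqrt_lt_R0 _ HP). lra. }
  assert (O35 : s3 < s5).
  { unfold s5, lambda5. apply admissible_iff in hAR as (_ & HP & _).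
    pose proof (sqrt_lt_R0 _ HP). lra. }
  (* The closed interval of the 1-wave lies strictly left of [s2] and that of the 6-wave strictly
     right of [s5], so both enter [W] uncut. *)
  set (W := fun xi => if Rlt_dec xi s2 then WL xi else if Rlt_dec xi s3 then BL
                      else if Rle_dec xi s5 then BR else refl (WR (- xi))).
  assert (EL : forall xi, xi < s2 -> W xi = WL xi).
  { intros xi Hxi. unfold W. destruct (Rlt_dec xi s2); [auto|lra]. }
  assert (ER : forall xi, s5 < xi -> W xi = refl (WR (- xi))).
  { intros xi Hxi. unfold W. destruct (Rlt_dec xi s2); [lra|].
    destruct (Rlt_dec xi s3); [lra|]. destruct (Rle_dec xi s5); [lra|auto]. }
  exists W. split.
  { intros xi. unfold W. destruct (Rlt_dec xi s2); auto. destruct (Rlt_dec xi s3); auto.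
    destruct (Rle_dec xi s5); auto. apply refl_admissible; auto. }
  exists AL, BL, BR, AR, a1, b1, s2, s3, s5, (- b), (- a).
  split; [auto|]. split; [lra|].
  split; [apply (wave1_eq g WL); auto; intros; apply EL; lra|].
  split; [auto|]. split; [auto|]. split; [auto|].
  split; [apply (wave6_eq g (fun xi => refl (WR (- xi)))); auto; intros; apply ER; lra|].
  split; [intros xi Hxi; rewrite EL by lra; apply QL1; auto|].
  split; [intros xi Hxi; rewrite EL by lra; apply QL2; lra|].
  split; [intros xi Hxi; unfold W; destruct (Rlt_dec xi s2); [lra|];
          destruct (Rlt_dec xi s3); [auto|lra]|].
  split; [intros xi Hxi; unfold W; destruct (Rlt_dec xi s2); [lra|];
          destruct (Rlt_dec xi s3); [lra|]; destruct (Rle_dec xi s5); [auto|lra]|].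
  split; intros xi Hxi; rewrite ER by lra.
  - rewrite QR2 by lra. reflexivity.
  - rewrite QR1 by lra. apply refl_involutive.
Qed.

Theorem theorem6 (g : R) (hg : 0 < g) (UL UR : state)
  (hUL : admissible UL) (hUR : admissible UR)
  (hnovac : vel1 UR - vel1 UL
            < afun g (depth UL) (R11 UL / depth UL ^ 3)
              + afun g (depth UR) (R11 UR / depth UR ^ 3)) :
  (exists! z : R * R,
      (0 < fst z < 2 /\ 0 < snd z < 2) /\
      Fstar g UL UR (fst z) (snd z) = 0 /\
      Gstar g UL UR (fst z) (snd z) = 0) /\
  (exists W : R -> state,
      riemann_solution g UL UR W /\ positive_profile W /\
      forall W' : R -> state, riemann_solution g UL UR W' -> same_profile W W').
Proof.
  pose proof (star_pair_exists_unique g UL UR hg hUL hUR hnovac) as Hz.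
  split; [exact Hz|]. destruct Hz as (z & Hz & Uz).
  destruct (riemann_solution_exists g UL UR z hg hUL hUR Hz) as [W HW].
  exists W. split; auto. split.
  - intros xi. apply (proj1 HW xi).
  - intros W' HW'. apply (riemann_solution_unique g UL UR); auto. exists z. split; auto.
Qed.
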